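(* Let $\Delta\ge 2$, $k\ge1$ and $\lambda>0$. There is a constant $\delta>0$ and a linear sketching scheme for probability distributions over $[\Delta]^2$ with sketch size $O(1)\,(\log^{\delta}\Delta)\,\big(k(\log\log\Delta)\log\log k+\log\log(\Delta/\lambda)\big)$ such that, given the sketch of a probability distribution $x$, one can recover a vector $x^*$ satisfying $$\mathrm{EMD}(x,x^* )\le\max\Big(O(\log k)\min_{k\text{-sparse } x'}\mathrm{EMD}(x,x'),\ \lambda\Big),$$ in time polynomial in $\Delta$ and $\log^{O(k)}\Delta$.
   Context: $[\Delta]=\{1,\dots,\Delta\}$. $\mathrm{EMD}$ between two probability distributions on $[\Delta]^2$ is the minimum transportation cost, moving mass $w$ from $a$ to $b$ costing $w\|a-b\|_1$; the minimum is over $k$-sparse probability distributions $x'$ (support of size at most $k$). A linear sketching scheme of size $m$ is a probability distribution over a matrix $A\in\mathbb{R}^{m\times[\Delta]^2}$ and a recovery algorithm applied to $Ax$; the recovery guarantee holds for each fixed input $x$ with constant probability over the randomness of the scheme. *)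

(* Defs.v *)
From HB Require Import structures.
From mathcomp Require Import all_boot all_order all_algebra.
From mathcomp Require Import all_classical all_reals all_analysis.

Set Implicit Arguments.
Unset Strict Implicit.
Unset Printing Implicit Defensive.

Import Order.TTheory GRing.Theory Num.Theory.
Import numFieldNormedType.Exports.

Local Open Scope classical_set_scope.
Local Open Scope ring_scope.

(* The grid {1, ..., D}^2, shifted to {0, ..., D-1}^2; only differences of
   coordinates are ever used. *)
Definition grid (D : nat) : finType := ('I_D * 'I_D)%type.

Section EarthMover.
Context {R : realType}.

Definition l1dist (D : nat) (a b : grid D) : R :=
  `|(a.1 : nat)%:R - (b.1 : nat)%:R| + `|(a.2 : nat)%:R - (b.2 : nat)%:R|.

Definition is_dist (D : nat) (x : grid D -> R) : Prop :=
  (forall p, 0 <= x p) /\ \sum_p x p = 1.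

Definition is_plan (D : nat) (x y : grid D -> R) (w : grid D -> grid D -> R) :
    Prop :=
  [/\ forall a b, 0 <= w a b,
      forall a, \sum_b w a b = x a &
      forall b, \sum_a w a b = y b].

Definition plan_cost (D : nat) (w : grid D -> grid D -> R) : R :=
  \sum_a \sum_b w a b * l1dist a b.

(* For distributions x and y the set of plans is nonempty and compact, so this
   infimum is the minimum.  The value is meaningless on other arguments: the
   real infimum of the empty set is 0. *)
Definition EMD (D : nat) (x y : grid D -> R) : R :=
  inf [set plan_cost w | w in [set w | is_plan x y w]].

Definition sparse (D k : nat) (x : grid D -> R) : Prop :=
  (#|[pred p | x p != 0%R]| <= k)%N.

(* Again a minimum for 1 <= k and 0 < D: the k-sparse distributions form a
   nonempty compact set on which EMD x is continuous. *)
Definition EMD_sparse (D k : nat) (x : grid D -> R) : R :=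
  inf [set EMD x x' | x' in [set x' | is_dist x' /\ sparse k x']].

(* Logarithms inside asymptotic bounds, truncated below at 1 so that iterated
   logarithms are defined and positive at small arguments. *)
Definition lg (t : R) : R := Num.max 1 (ln t / ln 2).

End EarthMover.

Section Sketching.
Variable R : realType.

Definition sketch (D m : nat) (A : 'I_m -> grid D -> R) (x : grid D -> R)
    (r : 'I_m) : R :=
  \sum_p A r p * x p.

(* The recovery algorithm knows the sampled matrix.  Randomness of its own is
   covered too: coins can be stored in an additional row of the matrix. *)
Record sketching_scheme (D m : nat) := SketchingScheme {
  scheme_disp : measure_display;
  scheme_space : measurableType scheme_disp;
  scheme_prob : probability scheme_space R;
  scheme_entry : 'I_m -> grid D -> {RV scheme_prob >-> R};
  scheme_recover : ('I_m -> grid D -> R) -> ('I_m -> R) -> grid D -> R }.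

Definition scheme_matrix (D m : nat) (S : sketching_scheme D m)
    (w : scheme_space S) : 'I_m -> grid D -> R :=
  fun r p => scheme_entry S r p w.

Definition scheme_output (D m : nat) (S : sketching_scheme D m)
    (w : scheme_space S) (x : grid D -> R) : grid D -> R :=
  scheme_recover S (scheme_matrix w) (sketch (scheme_matrix w) x).

(* The event [set w | good w] has probability at least p; stated with a
   measurable sub-event so that no measurability of good is presupposed. *)
Definition holds_with_prob (D m : nat) (S : sketching_scheme D m) (p : R)
    (good : scheme_space S -> Prop) : Prop :=
  exists E : set (scheme_space S),
    [/\ measurable E, (p%:E <= scheme_prob S E)%E & forall w, E w -> good w].

End Sketching.

(* Running time is measured on a real RAM with structured control: natural
   number arrays and real arrays, exact unit-cost + - * / and comparison on
   reals, no rounding of reals to integers, and no real constants in programs.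
   Natural numbers have only + and truncated -, so that a run of t steps
   keeps their bit length in O(t).  A program mentions finitely many
   arrays, which are named by numbers and unbounded. *)
Inductive nexp : Type :=
| NConst of nat
| NGet of nat & nexp
| NAdd of nexp & nexp
| NSub of nexp & nexp.

Inductive rexp : Type :=
| RNat of nexp
| RGet of nat & nexp
| RAdd of rexp & rexp
| RSub of rexp & rexp
| RMul of rexp & rexp
| RDiv of rexp & rexp.

Inductive bexp : Type :=
| BLeN of nexp & nexp
| BLeR of rexp & rexp
| BNot of bexp.

Inductive cmd : Type :=
| CSkip
| CSetN of nat & nexp & nexp
| CSetR of nat & nexp & rexp
| CSeq of cmd & cmd
| CIf of bexp & cmd & cmd
| CWhile of bexp & cmd.

Section Semantics.
Variable R : realType.

Record state := State { nmem : nat -> nat -> nat; rmem : nat -> nat -> R }.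

Fixpoint neval (s : state) (e : nexp) : nat :=
  match e with
  | NConst n => n
  | NGet a i => nmem s a (neval s i)
  | NAdd e1 e2 => (neval s e1 + neval s e2)%N
  | NSub e1 e2 => (neval s e1 - neval s e2)%N
  end.

Fixpoint reval (s : state) (e : rexp) : R :=
  match e with
  | RNat n => (neval s n)%:R
  | RGet a i => rmem s a (neval s i)
  | RAdd e1 e2 => reval s e1 + reval s e2
  | RSub e1 e2 => reval s e1 - reval s e2
  | RMul e1 e2 => reval s e1 * reval s e2
  | RDiv e1 e2 => reval s e1 / reval s e2
  end.

Fixpoint beval (s : state) (b : bexp) : bool :=
  match b with
  | BLeN e1 e2 => (neval s e1 <= neval s e2)%N
  | BLeR e1 e2 => reval s e1 <= reval s e2
  | BNot b1 => ~~ beval s b1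
  end.

Definition upd (V : Type) (f : nat -> nat -> V) (a i : nat) (v : V) :
    nat -> nat -> V :=
  fun a' i' => if (a' == a) && (i' == i) then v else f a' i'.

(* [exec c s t s'] : started in s, command c halts in s' after t steps, where
   every assignment and every test is one step.  The size of the expressions
   is bounded by the program, so this is the number of elementary operations
   up to a factor depending on the program only. *)
Inductive exec : cmd -> state -> nat -> state -> Prop :=
| ExecSkip s : exec CSkip s 0 s
| ExecSetN s a i e :
    exec (CSetN a i e) s 1
      (State (upd (nmem s) a (neval s i) (neval s e)) (rmem s))
| ExecSetR s a i e :
    exec (CSetR a i e) s 1
      (State (nmem s) (upd (rmem s) a (neval s i) (reval s e)))
| ExecSeq c1 c2 s s1 s2 t1 t2 :
    exec c1 s t1 s1 -> exec c2 s1 t2 s2 ->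
    exec (CSeq c1 c2) s (t1 + t2)%N s2
| ExecIfT b c1 c2 s s1 t :
    beval s b -> exec c1 s t s1 -> exec (CIf b c1 c2) s t.+1 s1
| ExecIfF b c1 c2 s s1 t :
    ~~ beval s b -> exec c2 s t s1 -> exec (CIf b c1 c2) s t.+1 s1
| ExecWhileT b c s s1 s2 t1 t2 :
    beval s b -> exec c s t1 s1 -> exec (CWhile b c) s1 t2 s2 ->
    exec (CWhile b c) s (t1 + t2).+1 s2
| ExecWhileF b c s :
    ~~ beval s b -> exec (CWhile b c) s 1 s.

(* Initial memory; all cells not listed are zero.
     natural array 0 : D, k, m
     real array 0    : lam
     real array 1    : the matrix, entry (r, (i, j)) at (r * D + i) * D + j
     real array 2    : the sketch *)
Definition load_nat (D k m : nat) (a i : nat) : nat :=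
  if a == 0%N then nth 0%N [:: D; k; m] i else 0%N.

Definition load_real (D m : nat) (lam : R) (A : 'I_m -> grid D -> R)
    (y : 'I_m -> R) (a i : nat) : R :=
  match a with
  | 0%N => if i == 0%N then lam else 0
  | 1%N => \sum_(r < m) \sum_(p : grid D)
             (if i == ((r * D + p.1) * D + p.2)%N then A r p else 0)
  | 2%N => \sum_(r < m) (if i == r :> nat then y r else 0)
  | _ => 0
  end.

Definition load (D k m : nat) (lam : R) (A : 'I_m -> grid D -> R)
    (y : 'I_m -> R) : state :=
  State (load_nat D k m) (load_real lam A y).

(* The result is read in real array 3, in row-major order. *)
Definition read_output (D : nat) (s : state) : grid D -> R :=
  fun p => rmem s 3 (p.1 * D + p.2)%N.

(* On every sampled matrix and every distribution x, the program computes the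
   output of the recovery algorithm from the matrix and the sketch of x within
   the given number of steps. *)
Definition recovery_runs_in (D k m : nat) (lam : R)
    (S : sketching_scheme R D m) (prog : cmd) (time : R) : Prop :=
  forall (w : scheme_space S) (x : grid D -> R), is_dist x ->
  exists (t : nat) (s : state),
    [/\ exec prog (load k lam (scheme_matrix w) (sketch (scheme_matrix w) x))
          t s,
        t%:R <= time &
        forall p, read_output s p = scheme_output w x p].

End Semantics.

(* Main.v *)
Require Import Defs.
From HB Require Import structures.
From mathcomp Require Import all_boot all_order all_algebra.
From mathcomp Require Import all_classical all_reals all_analysis.
From mathcomp Require Import zify ring lra.

Set Implicit Arguments.
Unset Strict Implicit.
Unset Printing Implicit Defensive.

Import Order.TTheory GRing.Theory Num.Theory.
Import numFieldNormedType.Exports.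

Local Open Scope classical_set_scope.
Local Open Scope ring_scope.

(* The output need not be sparse, so no clustering is required.  Fix a transport
   plan from x to a k-sparse distribution and the unshifted dyadic partitions of
   the grid.  At scale 2^i the cell masses of x are concentrated on the at most
   9k cells near the k centres, up to the mass F_i that the plan moves by at
   least 2^i, and the sum of the 2^i F_i is at most twice the cost of the plan.
   Count-min hashing into 20k buckets with O(log D) repetitions overestimates
   every cell mass by at most F_i / k, and keeping the top 10k estimates gives
   an error O(F_i) in l1 at each scale, without knowing the F_i.  Splitting mass
   1 from the root down in proportion to these estimates yields a distribution
   whose level-i error is O(F_i + F_(i+1) + ...), and matching mass inside cells
   from the finest scale up shows that its distance to x is at most a constant
   times the cost of the plan.  The tolerance lam only absorbs the
   approximation of the optimal plan when the optimum is 0. *)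

(** * Sparse recovery of the cell masses of one partition *)

(** Dyadic partitions are usually shifted at random, because a short move may cross a coarse
    boundary. The bound of EMD from above by cell discrepancies holds for the fixed nested
    partitions. In the other direction, cell masses are never compared with those of the sparse
    distribution: mass moved by less than 2^i starts in one of the nine cells around its target, and
    this concentration is all that hashing requires. An estimation error is inherited by every finer
    level, but a level is weighted by its cell diameter, so the inherited errors form a geometric
    series and cost a constant factor only. Functions of cells are represented as functions of
    points, constant on cells, each point being weighted by the inverse size of its cell. This
    spares an indexing of cells in the analysis and in the program alike. Rather than compute cells,
    the program reads weights and parents from the matrix, at the price of two more rows per
    level. *)

Section Partition.
Context {R : realType} {T : finType} {C : eqType}.
Implicit Types (kap : T -> C) (h : T -> R) (p q : T).

Definition cellsum kap h p : R := \sum_(q | kap q == kap p) h q.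

(** The points of a cell have total weight 1, so a weighted sum over points of a function constant
    on cells is a sum over nonempty cells. *)
Definition wgt kap p : R := (#|[pred q | kap q == kap p]|%:R)^-1.

Lemma wgt_gt0 kap p : 0 < wgt kap p.
Proof.
rewrite /wgt invr_gt0 ltr0n; apply/card_gt0P; exists p.
by rewrite inE eqxx.
Qed.

Lemma wgt_ge0 kap p : 0 <= wgt kap p.
Proof. exact/ltW/wgt_gt0. Qed.

Lemma sum_wgt_cell kap p : \sum_(q | kap q == kap p) wgt kap q = 1.
Proof.
rewrite (eq_bigr (fun=> wgt kap p)); last first.
  by move=> q /eqP qp; rewrite /wgt qp.
rewrite sumr_const -mulr_natl /wgt divff // pnatr_eq0 -lt0n.
by apply/card_gt0P; exists p; exact: eqxx.
Qed.

Lemma cellsum_eq kap h p q : kap p = kap q -> cellsum kap h p = cellsum kap h q.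
Proof. by rewrite /cellsum => ->. Qed.

Lemma sum_wgt_cellsum kap (P : pred C) h :
  \sum_(p | P (kap p)) wgt kap p * cellsum kap h p = \sum_(p | P (kap p)) h p.
Proof.
under eq_bigr do rewrite /cellsum mulr_sumr.
rewrite (exchange_big_dep (fun q => P (kap q))) /=; last first.
  by move=> p q Pp /eqP ->.
apply: eq_bigr => q Pq; rewrite -mulr_suml (eq_bigl (fun p => kap p == kap q)).
  by rewrite sum_wgt_cell mul1r.
move=> p; rewrite [kap q == _]eq_sym; case: eqP => [->|]; rewrite ?andbT ?andbF //.
Qed.

Lemma cellsum_ge0 kap h p : (forall q, 0 <= h q) -> 0 <= cellsum kap h p.
Proof. by move=> h0; apply: sumr_ge0. Qed.

(** The left side counts, once each, the names in [NS] that belong to nonempty cells. *)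
Lemma sum_wgt_mem kap (NS : seq C) :
  \sum_(p | kap p \in NS) wgt kap p <= (size NS)%:R.
Proof.
elim: NS => [|c NS IH]; first by rewrite big_pred0_eq.
rewrite (bigID (fun p => kap p == c)) /= -natr1 addrC lerD //.
  apply: le_trans IH; rewrite [leLHS]big_mkcond [leRHS]big_mkcond ler_sum //= => p _.
  rewrite inE; case: eqP => //= _; last by rewrite andbT.
  by rewrite ?andbF; case: ifP => // _; apply: wgt_ge0.
rewrite (eq_bigl (fun p => kap p == c)); last first.
  by move=> p; rewrite inE; case: eqP; rewrite ?andbF.
case: (pickP (fun p => kap p == c)) => [p /eqP <-|none].
  by rewrite sum_wgt_cell.
by rewrite big_pred0.
Qed.

End Partition.

Section LevelRecovery.
Context {R : realType} {T : finType} {C : eqType} (kap : T -> C).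

(** For [est] constant on cells, this is the number of cells whose estimate is at least that of the
    cell of [p], itself and ties included. *)
Definition rank_weight (est : T -> R) (p : T) : R :=
  \sum_q (if est p <= est q then wgt kap q else 0).

(** Cells tied across position [K] are all dropped. No sorting or tie-breaking is involved, and the
    result stays constant on cells. *)
Definition truncate_top (K : nat) (est : T -> R) (p : T) : R :=
  if rank_weight est p <= K%:R then est p else 0.

(** A survivor with the smallest estimate has all the survivors counted in its own rank. *)
Lemma sum_wgt_top (K : nat) (est : T -> R) :
  \sum_(p | rank_weight est p <= K%:R) wgt kap p <= K%:R :> R.
Proof.
case: (pickP (fun p : T => rank_weight est p <= K%:R)) => [p0 Hp0|none];
  last by rewrite big_pred0.
case: (@arg_minP _ _ _ p0 (fun p => rank_weight est p <= K%:R) est Hp0) => p Hp pmin.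
apply: le_trans Hp; rewrite /rank_weight [leLHS]big_mkcond /= ler_sum // => q _.
case: ifPn => Hq; first by rewrite pmin.
by case: ifP => // _; apply: wgt_ge0.
Qed.

(** 29 = 10 + 2 * 9 + 1: at most [10 * k] kept cells err by [F / k] each, at most [9 * k] dropped
    cells of [NS] lose [2 * F / k] each, and the dropped cells outside [NS] have total mass at most
    [F]. *)
Lemma truncate_top_error (k : nat) (x f est : T -> R) (NS : seq C) (F : R) :
  (0 < k)%N -> (forall p, 0 <= f p) -> (forall p, 0 <= x p) ->
  (size NS <= 9 * k)%N -> (forall p, kap p \notin NS -> x p = f p) ->
  F = \sum_p f p ->
  (forall p, cellsum kap x p <= est p <= cellsum kap x p + F / k%:R) ->
  \sum_p wgt kap p * `|truncate_top (10 * k) est p - cellsum kap x p|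
    <= 29 * F.
Proof.
move=> k0 f0 x0 sNS xf FE Hest.
have k0R : 0 < k%:R :> R by rewrite ltr0n.
have F0 : 0 <= F by rewrite FE sumr_ge0.
have xcf p : kap p \notin NS -> cellsum kap x p = cellsum kap f p.
  by move=> pN; apply: eq_bigr => q /eqP qp; rewrite xf // qp.
have fc0 p : 0 <= cellsum kap f p by exact: cellsum_ge0.
have xc0 p : 0 <= cellsum kap x p by exact: cellsum_ge0.
have sumf : \sum_p wgt kap p * cellsum kap f p = F.
  by rewrite FE; exact: (sum_wgt_cellsum kap xpredT).
have sizeNS : \sum_(p | kap p \in NS) wgt kap p <= 9 * k%:R :> R.
  apply: (le_trans (sum_wgt_mem kap NS)).
  by rewrite -natrM ler_nat.
(* Cells estimated above [2 * F / k] have mass above [F / k]; they lie among the [9 * k] names of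
   [NS] or are among the at most [k] cells whose share of [f] exceeds [F / k]. So any such cell has
   rank at most [10 * k]. *)
have light p : ~~ (rank_weight est p <= (10 * k)%:R) -> est p <= 2 * F / k%:R.
  apply: contraNT; rewrite -ltNge => big_p.
  have -> : (10 * k)%:R = 9 * k%:R + k%:R :> R by rewrite natrM; ring.
  have : \sum_q (if kap q \in NS then wgt kap q else 0) +
       \sum_q (if (F / k%:R < cellsum kap f q) then wgt kap q else 0)
       <= 9 * k%:R + k%:R :> R.
    apply: lerD; first by rewrite -big_mkcond.
    have [F00|Fn0] := eqVneq F 0.
      have fz q : f q = 0.
        apply/eqP; rewrite eq_le f0 andbT -F00 FE (bigD1 q) //= lerDl.
        by apply: sumr_ge0.
      rewrite big1 ?ltW // => q _; rewrite /cellsum big1 // F00 mul0r ltxx //.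
    have Fp : 0 < F by rewrite lt0r Fn0.
    rewrite [leRHS](_ : _ = \sum_q wgt kap q * cellsum kap f q * (k%:R / F)); last first.
      by rewrite -mulr_suml sumf; field.
    apply: ler_sum => q _; case: ifPn => [Hq|_].
      rewrite -mulrA ler_peMr ?wgt_ge0 // mulrA ler_pdivlMr // mul1r.
      by rewrite -ler_pdivrMr //; exact: ltW.
    by rewrite !mulr_ge0 ?wgt_ge0 ?invr_ge0.
  apply: le_trans; rewrite -big_split /= ler_sum // => q _.
  case: ifPn => [Hq|_]; last first.
    by rewrite addr_ge0 //; case: ifP => _ //; rewrite wgt_ge0.
  have qF : F / k%:R < cellsum kap x q.
    have := Hest q => /andP[_ H2]; have := lt_le_trans big_p Hq => H3.
    have : 2 * F / k%:R = F / k%:R + F / k%:R by rewrite -mulrA mulrDl mul1r.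
    by move: H2 H3; set u := F / _ => H2 H3 e; lra.
  case: ifPn => [qN|qN].
    by rewrite lerDl; case: ifP => _ //; rewrite wgt_ge0.
  by rewrite -xcf // qF add0r.
apply: (@le_trans _ _ (\sum_p ((if rank_weight est p <= (10 * k)%:R then wgt kap p * (F /
  k%:R) else 0)
   + (if kap p \in NS then wgt kap p * (2 * F / k%:R) else 0) + wgt kap p * cellsum kap f
     p))).
  apply: ler_sum => p _; rewrite /truncate_top; case: ifPn => Hp.
    have /andP[H1 H2] := Hest p.
    rewrite ger0_norm ?subr_ge0 // -addrA.
    apply: ler_wpDr; last by rewrite ler_wpM2l ?wgt_ge0 // lerBlDl.
    rewrite addr_ge0 ?mulr_ge0 ?wgt_ge0 //; case: ifP => _ //.
    by rewrite !mulr_ge0 ?wgt_ge0 ?invr_ge0.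
  rewrite sub0r normrN ger0_norm // add0r; case: ifPn => pN.
    apply: ler_wpDr; first by rewrite mulr_ge0 ?wgt_ge0.
    rewrite ler_wpM2l ?wgt_ge0 // (le_trans _ (light _ Hp)) //.
    by have /andP[] := Hest p.
  by rewrite add0r xcf.
rewrite !big_split /= sumf -!big_mkcond /= -!mulr_suml.
have -> : 29 * F = (10 * k%:R) * (F / k%:R) + 9 * k%:R * (2 * F / k%:R) + F.
  by field; rewrite gt_eqF.
by rewrite lerD // lerD // ler_wpM2r ?divr_ge0 ?mulr_ge0 // -natrM sum_wgt_top.
Qed.

End LevelRecovery.

(** * Transport along the dyadic partitions *)

Section Split.
Context {R : realType} {T : finType} {C C' : eqType}.
Context (kap : T -> C) (kap' : T -> C').
Implicit Types (a b x : T -> R).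

Definition child_sum b : T -> R := cellsum kap' (fun q => wgt kap q * b q).

(** The mass [a] of a parent is shared among its children in proportion to [b]. If all children have
    [b = 0], it is shared equally, [child_sum (fun=> 1)] being their number. *)
Definition split_mass a b p : R :=
  if child_sum b p <= 0 then a p / child_sum (fun=> 1) p
  else a p * b p / child_sum b p.

Lemma child_sum_ge0 b p : (forall q, 0 <= b q) -> 0 <= child_sum b p.
Proof. by move=> b0; apply: cellsum_ge0 => q; rewrite mulr_ge0 ?wgt_ge0. Qed.

Lemma child_sum1_gt0 p : 0 < child_sum (fun=> 1) p.
Proof.
rewrite /child_sum /cellsum (bigD1 p) //= mulr1 ltr_pwDl ?wgt_gt0 //.
by apply: sumr_ge0 => q _; rewrite mulr1 wgt_ge0.
Qed.

Lemma split_mass_ge0 a b p :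
  (forall q, 0 <= a q) -> (forall q, 0 <= b q) -> 0 <= split_mass a b p.
Proof.
move=> a0 b0; rewrite /split_mass; case: ifP => _.
  by rewrite divr_ge0 // ltW // child_sum1_gt0.
by rewrite divr_ge0 ?mulr_ge0 // child_sum_ge0.
Qed.

Hypothesis refine : forall p q, kap p = kap q -> kap' p = kap' q.

Lemma split_mass_cell a b :
  (forall p q, kap' p = kap' q -> a p = a q) ->
  (forall p q, kap p = kap q -> b p = b q) ->
  forall p q, kap p = kap q -> split_mass a b p = split_mass a b q.
Proof.
move=> ac bc p q pq; rewrite /split_mass /child_sum.
by rewrite !(cellsum_eq _ (refine pq)) (ac _ _ (refine pq)) (bc _ _ pq).
Qed.

Lemma child_sum_cell b p q : kap' p = kap' q -> child_sum b p = child_sum b q.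
Proof. exact: cellsum_eq. Qed.

Lemma child_sum_split_mass a b p :
  (forall p q, kap' p = kap' q -> a p = a q) ->
  child_sum (split_mass a b) p = a p.
Proof.
move=> ac.
pose c := if child_sum b p <= 0 then (child_sum (fun=> 1) p)^-1 else (child_sum b p)^-1.
have -> : child_sum (split_mass a b) p =
    a p * c * (if child_sum b p <= 0 then child_sum (fun=> 1) p else child_sum b p).
  rewrite {1}/child_sum /cellsum (eq_bigr (fun q => a p * c *
     (if child_sum b p <= 0 then wgt kap q * 1 else wgt kap q * b q))).
    by rewrite -mulr_sumr; case: ifP.
  move=> q /eqP qp; rewrite /split_mass !(child_sum_cell _ qp) (ac _ _ qp) /c.
  by case: ifP => _; ring.
rewrite /c; case: ifPn => H; first by rewrite -mulrA mulVf ?mulr1 // gt_eqF ?child_sum1_gt0.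
by rewrite -mulrA mulVf ?mulr1 // gt_eqF // ltNge.
Qed.

(** Inside a parent the split is a multiple of [b], or [b] vanishes; hence all differences from [b]
    have the same sign and their absolute values add up without loss. *)
Lemma split_mass_error a b :
  (forall q, 0 <= a q) -> (forall q, 0 <= b q) ->
  (forall p q, kap' p = kap' q -> a p = a q) ->
  \sum_p wgt kap p * `|split_mass a b p - b p|
    = \sum_p wgt kap' p * `|a p - child_sum b p|.
Proof.
move=> a0 b0 ac.
rewrite -(sum_wgt_cellsum kap' xpredT (fun p => wgt kap p * `|_|)).
apply: eq_bigr => p _; congr (_ * _).
have s0 : 0 <= child_sum b p := child_sum_ge0 p b0.
have [s_le|s_gt] := leP (child_sum b p) 0.
  have se : child_sum b p = 0 by apply/eqP; rewrite eq_le s_le.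
  rewrite se subr0 ger0_norm // -(child_sum_split_mass b p ac).
  apply: eq_bigr => q qp.
  have -> : wgt kap q * `|split_mass a b q - b q| =
     wgt kap q * `|split_mass a b q|.
    suff -> : b q = 0 by rewrite subr0.
    have /eqP := se; rewrite /child_sum /cellsum psumr_eq0; last first.
      by move=> r _; rewrite mulr_ge0 ?wgt_ge0.
    move=> /allP/(_ q (mem_index_enum _)); rewrite qp /= mulf_eq0.
    by rewrite gt_eqF ?wgt_gt0 //= => /eqP.
  by rewrite ger0_norm // split_mass_ge0.
rewrite /cellsum (eq_bigr (fun q => wgt kap q * b q * `|a p / child_sum b p - 1|)).
  rewrite -mulr_suml -/(cellsum kap' _ p) -/(child_sum b p).
  rewrite -[X in X * `|_ - 1| = _](ger0_norm s0) -normrM; congr `|_|.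
  by field; rewrite gt_eqF.
move=> q /eqP qp; rewrite /split_mass !(child_sum_cell _ qp) (ac _ _ qp) leNgt s_gt /=.
rewrite -[RHS]mulrA -[X in _ = _ * (X * _)](ger0_norm (b0 q)) -normrM; congr (_ * `|_|).
by field; rewrite gt_eqF.
Qed.

Lemma child_sum_cellsum x p : child_sum (cellsum kap x) p = cellsum kap' x p.
Proof.
have : exists g : C -> C', forall q, kap' q = g (kap q).
  (* The parent as a function of the child's name; a name that no point bears gets an arbitrary
     parent. *)
  exists (fun c => if [pick q | kap q == c] is Some q then kap' q else kap' p) => q.
  by case: pickP => [r /eqP rq|/(_ q)]; [apply: refine | rewrite eqxx].
case=> g gE; rewrite /child_sum /cellsum.
under eq_bigl do rewrite gE.
under [RHS]eq_bigl do rewrite gE.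
exact: (sum_wgt_cellsum kap (fun c => g c == kap' p)).
Qed.

(** The factor 2 arises because the errors of [b] enter once at the children and once more through
    their sum at the parent. *)
Lemma split_mass_cellsum_error a b x :
  (forall q, 0 <= a q) -> (forall q, 0 <= b q) ->
  (forall p q, kap' p = kap' q -> a p = a q) ->
  \sum_p wgt kap p * `|split_mass a b p - cellsum kap x p|
    <= \sum_p wgt kap' p * `|a p - cellsum kap' x p|
       + 2 * \sum_p wgt kap p * `|b p - cellsum kap x p|.
Proof.
move=> a0 b0 ac.
apply: (@le_trans _ _ (\sum_p wgt kap p * `|split_mass a b p - b p|
   + \sum_p wgt kap p * `|b p - cellsum kap x p|)).
  rewrite -big_split /= ler_sum // => p _; rewrite -mulrDr ler_wpM2l ?wgt_ge0 //.
  by rewrite ler_distD.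
rewrite split_mass_error // mulrDl mul1r addrA lerD2r.
rewrite -(sum_wgt_cellsum kap' xpredT (fun p => wgt kap p * `|b p - cellsum kap x p|)).
rewrite -big_split /= ler_sum // => p _; rewrite -mulrDr ler_wpM2l ?wgt_ge0 //.
apply: le_trans (ler_distD (cellsum kap' x p) _ _) _; rewrite lerD2l.
rewrite -child_sum_cellsum distrC /child_sum /cellsum -sumrB.
apply: le_trans (ler_norm_sum _ _ _) _; apply: ler_sum => q _.
by rewrite -mulrBr normrM ger0_norm ?wgt_ge0.
Qed.

End Split.

(** * Dyadic cells of the grid and the mass that a plan moves far *)

Section Grid.
Context {R : realType} {D : nat}.
Implicit Types (p q c : grid D) (i : nat).

(** Cells are named by their divided coordinates, which are again grid points, so hash functions on
    the grid can serve every scale. *)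
Definition cell i p : grid D :=
  (Ordinal (leq_ltn_trans (leq_div p.1 (2 ^ i)) (ltn_ord p.1)),
   Ordinal (leq_ltn_trans (leq_div p.2 (2 ^ i)) (ltn_ord p.2))).

Lemma cell0 p : cell 0 p = p.
Proof. by case: p => p1 p2; congr pair; apply: val_inj; rewrite /= divn1. Qed.

Lemma cellS i p q : cell i p = cell i q -> cell i.+1 p = cell i.+1 q.
Proof.
move=> [e1 e2]; congr pair; apply: val_inj;
  by rewrite /= expnSr !divnMA ?e1 ?e2.
Qed.

Lemma cell_top L p q : (D <= 2 ^ L)%N -> cell L p = cell L q.
Proof.
move=> DL; congr pair; apply: val_inj;
  by rewrite /= !divn_small // (leq_trans (ltn_ord _) DL).
Qed.

Lemma natr_dist (m n : nat) : `|m%:R - n%:R| = (maxn m n - minn m n)%:R :> R.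
Proof.
have [mn|nm] := leqP m n.
  by rewrite distrC ger0_norm ?natrB // subr_ge0 ler_nat.
by rewrite ger0_norm ?natrB ?(ltnW nm) // subr_ge0 ler_nat ltnW.
Qed.

Lemma l1dist_ge0 p q : 0 <= l1dist p q :> R.
Proof. by rewrite addr_ge0. Qed.

Lemma cell_diam i p q : cell i p = cell i q -> l1dist p q <= 2 * 2 ^+ i :> R.
Proof.
move=> [/eqP e1 /eqP e2].
have side (m n : nat) : (m %/ 2 ^ i == n %/ 2 ^ i)%N -> `|m%:R - n%:R| <= 2 ^+ i :> R.
  move=> /eqP mn; rewrite natr_dist -natrX ler_nat.
  have := divn_eq m (2 ^ i); have := divn_eq n (2 ^ i); rewrite mn.
  have := ltn_pmod m (expn_gt0 2 i); have := ltn_pmod n (expn_gt0 2 i).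
  by lia.
by rewrite /l1dist mulrDl mul1r lerD // side.
Qed.

(** The shifts -1, 0, 1 are coded as [u] = 0, 1, 2. At the border the value is truncated or falls
    back to [c], so a list of neighbours always has nine entries, possibly repeated. *)
Definition shift_ord (c : 'I_D) (u : nat) : 'I_D := insubd c (c + u - 1)%N.

Definition neighbours c : seq (grid D) :=
  [seq (shift_ord c.1 u, shift_ord c.2 v) | u <- iota 0 3, v <- iota 0 3].

Lemma mem_neighbours i p q :
  l1dist p q < 2 ^+ i :> R -> cell i p \in neighbours (cell i q).
Proof.
move=> pq.
have side (m n : nat) : `|m%:R - n%:R| < 2 ^+ i :> R ->
    ((m %/ 2 ^ i).+1 - n %/ 2 ^ i < 3)%N /\ (n %/ 2 ^ i <= (m %/ 2 ^ i).+1)%N.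
  rewrite natr_dist -natrX ltr_nat => H.
  have := divn_eq m (2 ^ i); have := divn_eq n (2 ^ i).
  have := ltn_pmod m (expn_gt0 2 i); have := ltn_pmod n (expn_gt0 2 i).
  set a := (m %/ _)%N; set b := (n %/ _)%N; set e := (2 ^ i)%N in H *.
  move=> h1 h2 h3 h4.
  have ab : (a <= b.+1)%N.
    rewrite leqNgt; apply/negP => ba.
    have : (b.+2 * e <= a * e)%N by rewrite leq_mul2r ba orbT.
    rewrite !mulSn; lia.
  have ba : (b <= a.+1)%N.
    rewrite leqNgt; apply/negP => ab'.
    have : (a.+2 * e <= b * e)%N by rewrite leq_mul2r ab' orbT.
    rewrite !mulSn; lia.
  by split => //; lia.
have [h1 h1'] : ((p.1 %/ 2 ^ i).+1 - q.1 %/ 2 ^ i < 3)%N /\ (q.1 %/ 2 ^ i <= (p.1 %/ 2 ^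
  i).+1)%N.
  by apply: side; apply: le_lt_trans pq; rewrite lerDl.
have [h2 h2'] : ((p.2 %/ 2 ^ i).+1 - q.2 %/ 2 ^ i < 3)%N /\ (q.2 %/ 2 ^ i <= (p.2 %/ 2 ^
  i).+1)%N.
  by apply: side; apply: le_lt_trans pq; rewrite lerDr.
(* The shift [u] solves [n + u - 1 = m] in each coordinate. *)
apply/allpairsP; exists (((p.1 %/ 2 ^ i).+1 - q.1 %/ 2 ^ i)%N, ((p.2 %/ 2 ^ i).+1 - q.2
  %/ 2 ^ i)%N).
split; rewrite ?mem_iota //=.
have e (m n : nat) : (n <= m.+1)%N -> (n + (m.+1 - n) - 1 = m)%N by lia.
congr pair; apply: val_inj; rewrite val_insubd /= e //.
  by rewrite (leq_ltn_trans (leq_div _ _)).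
by rewrite (leq_ltn_trans (leq_div _ _)).
Qed.

Definition far_mass (w : grid D -> grid D -> R) i p : R :=
  \sum_(q | 2 ^+ i <= l1dist p q :> R) w p q.

(** Mass moved by less than [2 ^+ i] ends at one of at most [k] support points of [x'], hence starts
    in one of the nine cells around it. A point in any other cell sends all its mass far. *)
Lemma far_mass_sparse (x x' : grid D -> R) w k i :
  is_plan x x' w -> sparse k x' ->
  exists2 NS : seq (grid D), (size NS <= 9 * k)%N &
    forall p, cell i p \notin NS -> x p = far_mass w i p.
Proof.
move=> [w0 wx wx'] sx'.
pose S := enum [pred p | x' p != 0].
exists (flatten [seq neighbours (cell i s) | s <- S]).
  have -> (s : seq (grid D)) :
      size (flatten [seq neighbours (cell i q) | q <- s]) = (9 * size s)%N.
    by elim: s => //= q s IH; rewrite IH mulnS.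
  by rewrite leq_mul2l /= /S -cardE.
move=> p pN; rewrite -wx /far_mass (bigID (fun q => 2 ^+ i <= l1dist p q :> R)) /=.
rewrite [X in _ + X]big1 ?addr0 // => q; rewrite -ltNge => pq.
apply/eqP; apply: contraNT pN => wpq; apply/flattenP.
exists (neighbours (cell i q)); last exact: (mem_neighbours pq).
apply: map_f; rewrite /S mem_enum inE -wx' gt_eqF //.
rewrite (bigD1 p) //= ltr_pwDl //; last by apply: sumr_ge0.
by rewrite lt0r wpq w0.
Qed.

Lemma sum_pow2_le (d : R) L : 0 <= d ->
  \sum_(i < L) (if 2 ^+ i <= d then 2 ^+ i else 0) <= 2 * d.
Proof.
move=> d0.
have geom n : \sum_(i < n) (if 2 ^+ i <= d then 2 ^+ i else 0) <= 2 ^+ n :> R.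
  elim: n => [|n IH]; first by rewrite big_ord0 expr0.
  rewrite big_ord_recr /= exprS mulrDl mul1r lerD //.
  by case: ifP => // _; rewrite exprn_ge0.
elim: L => [|L IH]; first by rewrite big_ord0 mulr_ge0.
rewrite big_ord_recr /=; case: ifPn => [H|_]; last by rewrite addr0.
apply: le_trans (_ : 2 ^+ L + 2 ^+ L <= _); first by rewrite lerD2r geom.
by rewrite mulrDl mul1r lerD.
Qed.

(** Mass moved over a distance d is far exactly at the scales with 2^i <= d, and these powers sum to
    at most 2d. *)
Lemma sum_far_mass_le (w : grid D -> grid D -> R) L :
  (forall p q, 0 <= w p q) ->
  \sum_(i < L) 2 ^+ i * \sum_p far_mass w i p <= 2 * plan_cost w.
Proof.
move=> w0; rewrite /plan_cost /far_mass.
under eq_bigr do rewrite mulr_sumr.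
rewrite exchange_big /= mulr_sumr ler_sum // => p _.
under eq_bigr do rewrite mulr_sumr big_mkcond /=.
rewrite exchange_big /= mulr_sumr ler_sum // => q _.
rewrite mulrCA (le_trans _ (ler_wpM2l (w0 p q) (sum_pow2_le L (l1dist_ge0 p q)))) //.
by rewrite mulr_sumr ler_sum // => i _; case: ifP => _; rewrite ?mulr0 // mulrC.
Qed.

End Grid.

(** * Upper bounds on EMD from the discrepancies of cell masses *)

Section Transport.
Context {R : realType} {D : nat}.
Implicit Types (x y z : grid D -> R) (w : grid D -> grid D -> R) (i L : nat).

Lemma plan_cost_ge0 w : (forall p q, 0 <= w p q) -> 0 <= plan_cost w.
Proof.
move=> w0; apply: sumr_ge0 => p _; apply: sumr_ge0 => q _.
by rewrite mulr_ge0 ?l1dist_ge0.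
Qed.

Lemma EMD_le_cost x y w : is_plan x y w -> EMD x y <= plan_cost w.
Proof.
move=> xyw; apply: ge_inf; last by exists w.
by exists 0 => _ [v [v0 _ _] <-]; exact: plan_cost_ge0.
Qed.

(** The product coupling shows that plans exist, so the infimum can be approached; near-optimal
    plans stand in for the minimum, which would call for compactness. *)
Lemma EMD_plan x y (e : R) : is_dist x -> is_dist y -> 0 < e ->
  exists2 w, is_plan x y w & plan_cost w < EMD x y + e.
Proof.
move=> [x0 x1] [y0 y1] e0.
have hi : has_inf [set plan_cost w | w in [set w | is_plan x y w]].
  split; last by exists 0 => _ [v [v0 _ _] <-]; exact: plan_cost_ge0.
  exists (plan_cost (fun p q => x p * y q)), (fun p q => x p * y q) => //.
  split => [p q|p|q]; first exact: mulr_ge0.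
    by rewrite -mulr_sumr y1 mulr1.
  by rewrite -mulr_suml x1 mul1r.
by have [_ [w xyw <-] H] := inf_adherent e0 hi; exists w.
Qed.

Lemma EMD_ge0 x y : is_dist x -> is_dist y -> 0 <= EMD x y.
Proof.
move=> dx dy; rewrite leNgt; apply/negP => E0.
have [|w [w0 _ _]] := @EMD_plan x y (- EMD x y) dx dy; first by rewrite oppr_gt0.
by rewrite addrN ltNge plan_cost_ge0.
Qed.

Lemma EMD_sparse_plan x k (e : R) : (0 < D)%N -> (0 < k)%N ->
  is_dist x -> 0 < e ->
  0 <= EMD_sparse k x /\
  exists y w, [/\ sparse k y, is_plan x y w & plan_cost w < EMD_sparse k x + e].
Proof.
move=> D0 k0 dx e0.
have hl : lbound [set EMD x x' | x' in [set x' | is_dist x' /\ sparse k x']] 0.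
  by move=> _ [y [dy _] <-]; exact: EMD_ge0.
have hi : has_inf [set EMD x x' | x' in [set x' | is_dist x' /\ sparse k x']].
  split; last by exists 0.
  pose o : grid D := (Ordinal D0, Ordinal D0).
  pose y p : R := (p == o)%:R.
  exists (EMD x y), y => //; split; first split.
  - by move=> p; rewrite ler0n.
  - rewrite (bigD1 o) //= /y eqxx big1 ?addr0 // => p.
    by move=> /negPf ->.
  - rewrite /sparse (leq_trans _ k0) // -(card1 o) subset_leq_card //.
    by apply/fintype.subsetP => p; rewrite !inE /y; case: (p == o) => //;
      rewrite mulr0n eqxx.
split; first by apply: lb_le_inf hl; case: hi.
have e2 : 0 < e / 2 by rewrite divr_gt0.
have [_ [y [dy sy] <-] H] := inf_adherent e2 hi.
have [w pw Hw] := EMD_plan dx dy e2.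
exists y, w; split => //; apply: lt_trans Hw _.
rewrite /EMD_sparse; move: H; set u := inf _; set v := EMD _ _; lra.
Qed.

Definition level_error i x z : R :=
  \sum_p wgt (cell i) p * `|cellsum (cell i) x p - cellsum (cell i) z p|.

Let row w p : R := \sum_q w p q.
Let column w q : R := \sum_p w p q.

(** A matching inside cells removes the same amount from both sides of each cell. *)
Lemma cellsum_residual i w x z p :
  (forall a b, w a b != 0 -> cell i a = cell i b) ->
  cellsum (cell i) (fun a => x a - row w a) p
    - cellsum (cell i) (fun b => z b - column w b) p
  = cellsum (cell i) x p - cellsum (cell i) z p.
Proof.
move=> wc; rewrite /cellsum !sumrB.
suff -> : \sum_(q | cell i q == cell i p) row w q
        = \sum_(q | cell i q == cell i p) column w q by ring.
have cond (P : bool) (f : grid D -> R) :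
    (if P then \sum_b f b else 0) = \sum_b (if P then f b else 0).
  by case: P => //; rewrite big1.
rewrite /row /column big_mkcond [RHS]big_mkcond /=.
under eq_bigr do rewrite cond.
under [RHS]eq_bigr do rewrite cond.
rewrite [RHS]exchange_big /=.
apply: eq_bigr => a _; apply: eq_bigr => b _.
have [->|/wc ->] := eqVneq (w a b) 0; by rewrite ?if_same.
Qed.

(* Mass is matched inside cells, level by level from the finest one; after
   level i every cell has an exhausted side, so what remains of x in a cell is
   at most the discrepancy of the two cell masses. *)
Lemma greedy_matching x z i :
  (forall p, 0 <= x p) -> (forall p, 0 <= z p) ->
  exists w,
  [/\ (forall p q, 0 <= w p q) /\ (forall p q, w p q != 0 -> cell i p = cell i q),
      forall p, row w p <= x p, forall q, column w q <= z q,
      forall p, cellsum (cell i) (fun a => x a - row w a) p = 0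
             \/ cellsum (cell i) (fun b => z b - column w b) p = 0 &
      plan_cost w <= \sum_(j < i) 4 * 2 ^+ j * level_error j x z].
Proof.
move=> x0 z0; elim: i => [|i [w [[w0 wc] wx wz wr cw]]].
  exists (fun p q => if p == q then Num.min (x p) (z p) else 0).
  have rowE p : row (fun p q => if p == q then Num.min (x p) (z p) else 0) p = Num.min (x
    p) (z p).
    rewrite /row (bigD1 p) //= eqxx big1 ?addr0 // => q.
    by rewrite eq_sym => /negPf ->.
  have colE p : column (fun p q => if p == q then Num.min (x p) (z p) else 0) p = Num.min
    (x p) (z p).
    by rewrite /column (bigD1 p) //= eqxx big1 ?addr0 // => q /negPf ->.
  split.
  - split=> p q; first by case: ifP => // _; rewrite le_min x0 z0.
    by case: ifP => [/eqP -> //|]; rewrite eqxx.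
  - by move=> p; rewrite rowE ge_min lexx.
  - by move=> p; rewrite colE ge_min lexx orbT.
  - move=> p; have single (f : grid D -> R) : cellsum (cell 0) f p = f p.
      by rewrite /cellsum (big_pred1 p) // => q /=; rewrite !cell0.
    rewrite !single rowE colE; case: (leP (x p) (z p)) => _; rewrite subrr.
      by left.
    by right.
  - rewrite big_ord0 /plan_cost big1 // => p _; rewrite big1 // => q _.
    by case: eqP => [->|_]; rewrite /l1dist ?subrr ?normr0 ?addr0 ?mulr0 ?mul0r.
pose r p := x p - row w p; pose s q := z q - column w q.
have r0 p : 0 <= r p by rewrite subr_ge0.
have s0 p : 0 <= s p by rewrite subr_ge0.
pose ru := cellsum (cell i.+1) r; pose su := cellsum (cell i.+1) s.
have ru0 p : 0 <= ru p by exact: cellsum_ge0.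
have su0 p : 0 <= su p by exact: cellsum_ge0.
(* Dividing the product of the residues by the larger of their two totals gives a coupling that
   exhausts the smaller side. If both totals are 0, division by 0 yields 0, as it should. *)
pose M p := Num.max (ru p) (su p).
have M0 p : 0 <= M p by rewrite le_max ru0.
have sM p : su p / M p <= 1.
  have [->|Mn] := eqVneq (M p) 0; first by rewrite invr0 mulr0.
  by rewrite ler_pdivrMr ?mul1r ?le_max ?lexx ?orbT // lt0r Mn M0.
have rM p : ru p / M p <= 1.
  have [->|Mn] := eqVneq (M p) 0; first by rewrite invr0 mulr0.
  by rewrite ler_pdivrMr ?mul1r ?le_max ?lexx // lt0r Mn M0.
have ME p q : cell i.+1 p = cell i.+1 q -> M p = M q.
  by move=> e; rewrite /M /ru /su !(cellsum_eq _ e).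
pose v p q := if cell i.+1 q == cell i.+1 p then r p * s q / M p else 0.
have v0 p q : 0 <= v p q.
  by rewrite /v; case: ifP => // _; rewrite divr_ge0 // mulr_ge0.
have rowv p : row v p = r p * (su p / M p).
  rewrite /row /v -big_mkcond /= mulrA /su /cellsum mulr_sumr mulr_suml.
  by [].
have colv q : column v q = s q * (ru q / M q).
  rewrite /column /v (eq_bigr (fun p => if cell i.+1 p == cell i.+1 q then s q * r p / M
    q else 0)).
    by rewrite -big_mkcond /= mulrA /ru /cellsum mulr_sumr mulr_suml.
  move=> p _; rewrite eq_sym; case: eqP => // /ME ->.
  by rewrite [r p * _]mulrC.
exists (fun p q => w p q + v p q).
have rowD p : row (fun p q => w p q + v p q) p = row w p + row v p by rewrite /row
  big_split.
have colD p : column (fun p q => w p q + v p q) p = column w p + column v p by rewrite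
  /column big_split.
split.
- split=> p q; first by rewrite addr_ge0.
  have [w_eq|/wc/cellS //] := eqVneq (w p q) 0.
  by rewrite w_eq add0r /v; have [->|_] := eqVneq (cell i.+1 q); rewrite ?eqxx.
- by move=> p; rewrite rowD -lerBrDl rowv ler_piMr // -/(r p) r0.
- by move=> p; rewrite colD -lerBrDl colv ler_piMr // -/(s p) s0.
- move=> p.
  have e1 : cellsum (cell i.+1) (fun a => x a - row (fun p q => w p q + v p q) a) p
      = ru p * (1 - su p / M p).
    rewrite /ru /cellsum mulr_suml; apply: eq_bigr => q /eqP qp.
    by rewrite rowD rowv /su (cellsum_eq _ qp) (ME _ _ qp) /r; ring.
  have e2 : cellsum (cell i.+1) (fun a => z a - column (fun p q => w p q + v p q) a) p
      = su p * (1 - ru p / M p).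
    rewrite /su /cellsum mulr_suml; apply: eq_bigr => q /eqP qp.
    by rewrite colD colv /ru (cellsum_eq _ qp) (ME _ _ qp) /s; ring.
  rewrite e1 e2 /M; have [rs|sr] := leP (ru p) (su p).
    left; have [s00|sn] := eqVneq (su p) 0.
      have -> : ru p = 0 by apply/eqP; rewrite eq_le ru0 andbT -s00.
      by rewrite mul0r.
    by rewrite divff // subrr mulr0.
  by right; rewrite divff ?subrr ?mulr0 // gt_eqF // (le_lt_trans (su0 p)).
- rewrite big_ord_recr /=.
  have -> : plan_cost (fun p q => w p q + v p q) = plan_cost w + plan_cost v.
    rewrite /plan_cost -big_split /=; apply: eq_bigr => p _.
    by rewrite -big_split /=; apply: eq_bigr => q _; rewrite mulrDl.
  rewrite lerD //.
  (* Matching at level [i.+1] is charged to level [i]: a move is no longer than the diameter of the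
     coarser cell, and the mass moved is at most what level [i] left unmatched. *)
  have diam : 4 * 2 ^+ i = 2 * 2 ^+ i.+1 :> R by rewrite exprS; ring.
  apply: (@le_trans _ _ (4 * 2 ^+ i * \sum_p row v p)).
    rewrite diam mulr_sumr /plan_cost ler_sum // => p _;
      rewrite mulr_sumr ler_sum // => q _.
    rewrite [leRHS]mulrC /v; case: eqP => [e|_]; last by rewrite !mul0r.
    rewrite ler_wpM2l //; first by rewrite divr_ge0 ?mulr_ge0.
    exact: cell_diam.
  rewrite ler_wpM2l ?mulr_ge0 ?exprn_ge0 //.
  apply: (@le_trans _ _ (\sum_p r p)).
    by apply: ler_sum => p _; rewrite rowv ler_piMr.
  rewrite -(sum_wgt_cellsum (cell i) xpredT r) ler_sum // => p _.
  rewrite ler_wpM2l ?wgt_ge0 //.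
  rewrite -(cellsum_residual _ _ _ wc); case: (wr p) => ->.
    exact: normr_ge0.
  by rewrite subr0 ler_norm.
Qed.

(** At level [L] the grid is a single cell. As both masses are 1, exhausting one side exhausts the
    other, and the greedy matching is a full plan. *)
Lemma EMD_le_level_errors x z L : (D <= 2 ^ L)%N -> is_dist x -> is_dist z ->
  EMD x z <= \sum_(j < L) 4 * 2 ^+ j * level_error j x z.
Proof.
move=> DL [x0 x1] [z0 z1].
have [w [[w0 wc] wx wz wr cw]] := greedy_matching L x0 z0.
apply: le_trans cw; apply: EMD_le_cost.
have sums : \sum_p (x p - row w p) = \sum_p (z p - column w p).
  by rewrite !sumrB x1 z1 /row /column exchange_big.
have top (h : grid D -> R) p : cellsum (cell L) h p = \sum_q h q.
  by apply: eq_bigl => q; rewrite (cell_top q p DL) eqxx.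
have xr p : x p - row w p = 0.
  suff /eqP : \sum_p (x p - row w p) = 0.
    rewrite psumr_eq0 => [/allP/(_ p (mem_index_enum _))/eqP //|q _].
    by rewrite subr_ge0.
  by case: (wr p); rewrite top => e //; rewrite sums.
have zr p : z p - column w p = 0.
  suff /eqP : \sum_p (z p - column w p) = 0.
    rewrite psumr_eq0 => [/allP/(_ p (mem_index_enum _))/eqP //|q _].
    by rewrite subr_ge0.
  by case: (wr p); rewrite top => e //; rewrite -sums.
split=> // p; apply/esym/eqP; rewrite -subr_eq0; apply/eqP; [exact: xr|exact: zr].
Qed.

Fixpoint allocate L (b : nat -> grid D -> R) (j : nat) : grid D -> R :=
  if j is j'.+1 then
    let i := (L - j)%N in
    split_mass (cell i) (cell i.+1) (allocate L b j') (b i)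
  else fun=> 1.

Section Allocate.
Variables (L : nat) (b : nat -> grid D -> R).
Hypothesis DL : (D <= 2 ^ L)%N.
Hypothesis b0 : forall i p, 0 <= b i p.
Hypothesis bc : forall i p q, cell i p = cell i q -> b i p = b i q.

Lemma allocate_ge0 j p : 0 <= allocate L b j p.
Proof.
by elim: j p => [p|j IH p] /=; [exact: ler01 | exact: split_mass_ge0].
Qed.

Lemma allocate_cell j p q : (j <= L)%N ->
  cell (L - j) p = cell (L - j) q -> allocate L b j p = allocate L b j q.
Proof.
elim: j p q => [//|j IH] p q jL pq /=.
apply: (split_mass_cell (kap := cell (L - j.+1)) (kap' := cell (L - j.+1).+1)) => //.
- exact: cellS.
- by move=> u v; rewrite subnSK // => uv; apply: IH => //; exact: ltnW.
- exact: bc.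
Qed.

(** Later splits preserve the mass of each cell. The induction climbs from the finest scale
    [d = 0]. *)
Lemma cellsum_allocate j : (j <= L)%N ->
  forall p, cellsum (cell (L - j)) (allocate L b L) p = allocate L b j p.
Proof.
move=> jL; rewrite -(subKn jL); move: (leq_subr j L); move: (L - j)%N => d.
elim: d => [|d IH] dL p.
  rewrite !subn0 subnn /cellsum (big_pred1 p) // => q /=; by rewrite !cell0.
have dE : (L - (L - d.+1) = d.+1)%N by rewrite subKn.
rewrite dE -(child_sum_cellsum (kap := cell d)); last by move=> u v; exact: cellS.
have dE' : (L - d = (L - d.+1).+1)%N by rewrite subnSK.
have := @child_sum_split_mass R _ _ _ (cell d) (cell d.+1)
  (allocate L b (L - d.+1)) (b d) p.
move=> <-; last first.
  by move=> u v uv; apply: allocate_cell; rewrite ?leq_subr // dE.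
rewrite /child_sum; apply: eq_bigr => q _; congr (_ * _).
have := IH (ltnW dL) q; rewrite subKn ?(ltnW dL) // => ->.
by rewrite dE' /= -dE' subKn // ltnW.
Qed.

Lemma allocate_dist : (0 < D)%N -> is_dist (allocate L b L).
Proof.
move=> D0; split=> [p|]; first exact: allocate_ge0.
have := cellsum_allocate (leq0n L) (Ordinal D0, Ordinal D0); rewrite subn0 /= => <-.
by apply: eq_bigl => q; rewrite (cell_top q (Ordinal D0, Ordinal D0) DL) eqxx.
Qed.

Lemma level_error_allocate x i : (i < L)%N ->
  level_error i (allocate L b L) x <= level_error i.+1 (allocate L b L) x
    + 2 * \sum_p wgt (cell i) p * `|b i p - cellsum (cell i) x p|.
Proof.
move=> iL.
have key d : (d <= L)%N -> level_error d (allocate L b L) x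
   = \sum_p wgt (cell d) p * `|allocate L b (L - d) p - cellsum (cell d) x p|.
  move=> dL; apply: eq_bigr => p _.
  by have := cellsum_allocate (leq_subr d L) p; rewrite subKn // => ->.
rewrite !key // 1?ltnW // -[(L - i)%N]subnSK //= subnSK // subKn //; last exact: ltnW.
apply: split_mass_cellsum_error => //.
- exact: cellS.
- by move=> p; exact: allocate_ge0.
- by move=> u v uv; apply: allocate_cell; rewrite ?leq_subr // subKn.
Qed.

(** 16 = 4 * 4, one factor from the matching and one from telescoping: the error at level [i] is at
    most that at [i.+1] plus [2 * G i], weights double from level to level, and the root has no
    error because both masses are 1. *)
Lemma EMD_allocate x : (0 < D)%N -> is_dist x ->
  EMD x (allocate L b L) <=
    16 * \sum_(i < L) 2 ^+ i * \sum_p wgt (cell i) p * `|b i p - cellsum (cell i) x p|.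
Proof.
move=> D0 dx; apply: le_trans (EMD_le_level_errors DL dx (allocate_dist D0)) _.
pose G i := \sum_p wgt (cell i) p * `|b i p - cellsum (cell i) x p|.
pose Er i := level_error i (allocate L b L) x.
have Er0 i : 0 <= Er i by apply: sumr_ge0 => p _; rewrite mulr_ge0 ?wgt_ge0.
have ErL : Er L = 0.
  rewrite /Er /level_error big1 // => p _.
  have -> : cellsum (cell L) (allocate L b L) p = 1.
    by have := cellsum_allocate (leq0n L) p; rewrite subn0.
  have -> : cellsum (cell L) x p = 1.
    by rewrite -dx.2; apply: eq_bigl => q; rewrite (cell_top q p DL) eqxx.
  by rewrite subrr normr0 mulr0.
have tele n : (n <= L)%N ->
    \sum_(i < n) 2 ^+ i * Er i <= 2 ^+ n * Er n + 4 * \sum_(i < n) 2 ^+ i * G i.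
  elim: n => [|n IH] nL; first by rewrite !big_ord0 mulr0 addr0 mulr_ge0 ?exprn_ge0.
  rewrite !big_ord_recr /=; have := IH (ltnW nL).
  have : 2 ^+ n * Er n <= 2 ^+ n * (Er n.+1 + 2 * G n).
    by rewrite ler_wpM2l ?exprn_ge0 // level_error_allocate.
  rewrite exprS; set u := \sum_(_ < _) _; set v := \sum_(_ < _) _.
  by set e := 2 ^+ n; move=> h1 h2; lra.
have := tele L (leqnn L); rewrite ErL mulr0 add0r => H.
apply: (@le_trans _ _ (4 * \sum_(i < L) 2 ^+ i * Er i)).
  rewrite mulr_sumr ler_sum // => i _; rewrite -mulrA ler_wpM2l //.
  rewrite ler_wpM2l ?exprn_ge0 // /Er /level_error.
  by apply: ler_sum => p _; rewrite distrC.
have -> : 16 * \sum_(i < L) 2 ^+ i * G i = 4 * (4 * \sum_(i < L) 2 ^+ i * G i) by ring.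
by rewrite ler_wpM2l.
Qed.

End Allocate.

(** 928 = 16 * 29 * 2: allocation, truncation, and the sum of the far masses over all scales. *)
Lemma EMD_allocate_truncate x y w k L (est : nat -> grid D -> R) :
  (0 < D)%N -> (D <= 2 ^ L)%N -> (0 < k)%N -> is_dist x ->
  sparse k y -> is_plan x y w ->
  (forall i p, 0 <= est i p) ->
  (forall i p q, cell i p = cell i q -> est i p = est i q) ->
  (forall i p, (i < L)%N -> cellsum (cell i) x p <= est i p
     <= cellsum (cell i) x p + (\sum_q far_mass w i q) / k%:R) ->
  EMD x (allocate L (fun i => truncate_top (cell i) (10 * k) (est i)) L)
    <= 928 * plan_cost w.
Proof.
move=> D0 DL k0 dx sy pw est0 estc estx; have [w0 _ _] := pw.
apply: le_trans (EMD_allocate (b := fun i => truncate_top (cell i) (10 * k) (est i)) DL _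
  _ D0 dx) _.
- by move=> i p; rewrite /truncate_top; case: ifP.
- move=> i p q pq; rewrite /truncate_top /rank_weight (estc _ _ _ pq) //.
have -> : 928 * plan_cost w = 16 * (29 * (2 * plan_cost w)) by ring.
rewrite ler_wpM2l //.
apply: le_trans (ler_wpM2l _ (sum_far_mass_le L w0)); last by [].
rewrite mulr_sumr ler_sum // => i _; rewrite mulrCA ler_wpM2l ?exprn_ge0 //.
have [NS sNS fE] := far_mass_sparse i pw sy.
apply: (truncate_top_error (f := far_mass w i) (NS := NS)) => //.
- by move=> p; apply: sumr_ge0.
- by case: dx.
- by move=> p; apply: estx.
Qed.

End Transport.

(** * Count-min hashing *)

Section Hashing.
Context {R : realType} {T : finType}.
Implicit Types (kap : T -> T) (x f : T -> R).

(** Overwriting [h c] by an arbitrary bucket is injective on colliding functions, since the lost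
    value can be read off at [c0]. *)
Lemma card_collision (B : nat) (c c0 : T) : c != c0 ->
  (#|[pred h : {ffun T -> 'I_B} | h c == h c0]| * B <= #|{ffun T -> 'I_B}|)%N.
Proof.
move=> cc0; pose g (u : {ffun T -> 'I_B} * 'I_B) : {ffun T -> 'I_B} :=
  [ffun t => if t == c then u.2 else u.1 t].
rewrite -[X in (_ * X)%N](card_ord B) -cardX.
apply: (leq_card_in g).
move=> [h b] [h' b']; rewrite !inE /= !andbT => /eqP hc /eqP hc' e.
have bb : b = b' by have := congr1 (fun u : {ffun T -> 'I_B} => u c) e; rewrite !ffunE eqxx.
rewrite bb; congr pair; apply/ffunP => t.
have off t' : t' != c -> h t' = h' t'.
  move=> tc; have := congr1 (fun u : {ffun T -> 'I_B} => u t') e.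
  by rewrite !ffunE (negPf tc).
have [->|tc] := eqVneq t c; last exact: off.
by rewrite hc hc' off // eq_sym.
Qed.

Definition noise kap (h : T -> nat) x p : R :=
  \sum_(q | (kap q != kap p) && (h (kap q) == h (kap p))) x q.

Lemma bucket_mass kap (h : T -> nat) x p :
  \sum_(q | h (kap q) == h (kap p)) x q = cellsum kap x p + noise kap h x p.
Proof.
rewrite (bigID (fun q => kap q == kap p)) /=; congr (_ + _).
  by apply: eq_bigl => q; case: (eqVneq (kap q)) => [->|]; rewrite ?eqxx ?andbF.
by apply: eq_bigl => q; rewrite andbC.
Qed.

Lemma sum_comp kap f (P : pred T) :
  \sum_(c | P c) \sum_(q | kap q == c) f q = \sum_(q | P (kap q)) f q.
Proof.
rewrite (exchange_big_dep (fun q => P (kap q))) /=; last by move=> c q Pc /eqP ->.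
apply: eq_bigr => q Pq; rewrite (big_pred1 (kap q)) // => c /=.
by rewrite eq_sym; case: (eqVneq c) => [->|]; rewrite ?Pq ?andbF.
Qed.

(* Markov for the collision cost Z, which charges 1 for each cell of NS and
   k/F times its mass for the others. *)
Lemma card_noise (k : nat) kap x f (NS : seq T) (F : R) p :
  (0 < k)%N -> (forall q, 0 <= f q) ->
  (size NS <= 9 * k)%N -> (forall q, kap q \notin NS -> x q = f q) ->
  F = \sum_q f q ->
  (2 * #|[pred h : {ffun T -> 'I_(20 * k)} | (F / k%:R < noise kap (fun c => h c) x p)%R]|
     <= #|{ffun T -> 'I_(20 * k)}|)%N.
Proof.
move=> k0 f0 sNS xf FE; set B := (20 * k)%N.
have k0R : 0 < k%:R :> R by rewrite ltr0n.
have F0 : 0 <= F by rewrite FE sumr_ge0.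
pose fc c := \sum_(q | kap q == c) f q.
have fc0 c : 0 <= fc c by apply: sumr_ge0.
pose Z c : R := (c \in NS)%:R + k%:R / F * fc c.
have Z0 c : 0 <= Z c by rewrite addr_ge0 ?ler0n // mulr_ge0 // divr_ge0 // ltW.
(* [9 * k] for the names in [NS] plus [k] for the rest. Over [20 * k] buckets the mean collision
   cost is therefore at most 1/2. *)
have sumZ : \sum_c Z c <= 10 * k%:R.
  rewrite big_split /= -mulr_sumr (sum_comp kap f xpredT) -FE.
  have -> : 10 * k%:R = (9 * k)%:R + k%:R :> R by rewrite natrM; ring.
  apply: lerD.
    rewrite -natr_sum ler_nat (leq_trans _ sNS) //.
    rewrite (eq_bigr (fun c => if c \in NS then 1 else 0)%N); last by move=> c _;
      case: (c \in NS).
    by rewrite -big_mkcond sum1_card card_size.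
  have [->|Fn] := eqVneq F 0; first by rewrite mulr0 ltW.
  by rewrite divfK.
pose coll (h : {ffun T -> 'I_B}) c := (c != kap p) && (h c == h (kap p)).
(* Either a cell of [NS] collides, which alone costs 1, or the noise consists of [f] only and
   exceeds [F / k]. For [F = 0] the latter is impossible. *)
have badZ (h : {ffun T -> 'I_B}) : F / k%:R < noise kap (fun c => h c) x p ->
    1 <= \sum_(c | coll h c) Z c.
  move=> Hn; have [c /andP[cN hc]|noNS] := pickP (fun c => (c \in NS) && coll h c).
    rewrite (bigD1 c) //= /Z cN -addrA lerDl addr_ge0 //.
      by rewrite mulr_ge0 // divr_ge0 // ltW.
    by apply: sumr_ge0 => i _; apply: Z0.
  have nE : noise kap (fun c => h c) x p = \sum_(c | coll h c) fc c.
    rewrite /fc sum_comp; apply: eq_bigr => q hq; apply: xf.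
    by have := noNS (kap q); rewrite /coll hq andbT => ->.
  have [F00|Fn] := eqVneq F 0.
    suff : noise kap (fun c => h c) x p <= 0.
      by rewrite leNgt; move: Hn; rewrite F00 mul0r => ->.
    apply: (@le_trans _ _ F); last by rewrite F00.
    by rewrite nE FE /fc sum_comp big_mkcond /= ler_sum // => q _; case: ifP.
  apply: (@le_trans _ _ (k%:R / F * noise kap (fun c => h c) x p)).
    rewrite mulrAC ler_pdivlMr ?lt0r ?Fn // mul1r mulrC -ler_pdivrMr //.
    exact: ltW.
  by rewrite nE mulr_sumr ler_sum // => c _; rewrite lerDr ler0n.
have H : (#|[pred h : {ffun T -> 'I_B} | F / k%:R < noise kap (fun c => h c) x p]|)%:R
   <= \sum_(c | c != kap p) Z c * (#|[pred h : {ffun T -> 'I_B} | h c == h (kap p)]|)%:R.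
  apply: (@le_trans _ _ (\sum_(h : {ffun T -> 'I_B}) \sum_(c | coll h c) Z c)).
    rewrite -sum1_card natr_sum big_mkcond /= ler_sum // => h _.
    rewrite inE; case: ifP => [/badZ //|_].
    by apply: sumr_ge0.
  rewrite (exchange_big_dep (fun c => c != kap p)) /=; last first.
    by move=> h c _ /andP[].
  apply: ler_sum => c cp; rewrite (eq_bigl (fun h : {ffun T -> 'I_B} => h c == h (kap p))).
    by rewrite sumr_const mulr_natr.
  by move=> h; rewrite /coll cp.
have Bp : 0 < B%:R :> R by rewrite ltr0n muln_gt0.
rewrite -(ler_nat R) natrM; apply: le_trans (ler_wpM2l _ H) _; first exact: ler0n.
have : \sum_(c | c != kap p) Z c * (#|[pred h : {ffun T -> 'I_B} | h c == h (kap p)]|)%:R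
   <= (\sum_c Z c) * (#|{ffun T -> 'I_B}|%:R / B%:R).
  rewrite mulr_suml big_mkcond ler_sum //= => c _; case: ifPn => [cp|_]; last first.
    by rewrite mulr_ge0 // divr_ge0.
  by rewrite ler_wpM2l // ler_pdivlMr // -natrM ler_nat card_collision.
move=> H2; apply: le_trans (ler_wpM2l _ H2) _; first exact: ler0n.
rewrite mulrA -[leRHS](mulfK (lt0r_neq0 Bp)) -[leRHS]mulrA.
rewrite mulrCA ler_wpM2l //.
rewrite ler_pdivlMr // mulfVK ?lt0r_neq0 // /B natrM.
by apply: le_trans (ler_wpM2l _ sumZ) _ => //; lra.
Qed.

(** Independence of the repetitions, in counting form: the tuples with all entries bad form a
    power. *)
Lemma card_all_bad (H : finType) (bad : pred H) (r : nat) :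
  (2 * #|[pred h | bad h]| <= #|H|)%N ->
  (2 ^ r * #|[pred w : {ffun 'I_r -> H} | [forall s, bad (w s)]]|
     <= #|{ffun 'I_r -> H}|)%N.
Proof.
move=> Hb; rewrite card_ffun card_ord.
have -> : #|[pred w : {ffun 'I_r -> H} | [forall s, bad (w s)]]| = (#|[pred h | bad h]| ^
  r)%N.
  rewrite -[X in (_ ^ X)%N](card_ord r) -card_ffun_on; apply: eq_card => w.
  rewrite inE; apply/forallP/ffun_onP => bw s; exact: bw s.
case: r => [|r]; first by rewrite !expn0.
by rewrite -expnMn leq_exp2r.
Qed.

Lemma card_exists_le (I W : finType) (A : I -> pred W) :
  (#|[pred w | [exists i, A i w]]| <= \sum_i #|[pred w | A i w]|)%N.
Proof.
under eq_bigr do rewrite -sum1_card big_mkcond /=.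
rewrite exchange_big -sum1_card big_mkcond /= leq_sum // => w _.
rewrite inE; case: existsP => // -[i Aiw].
by rewrite (bigD1 i) //= inE Aiw.
Qed.

End Hashing.

(** * The recovery program *)

Section Hoare.
Context {R : realType}.
Implicit Types (s : state R) (c : cmd) (Q : state R -> Prop).

Fixpoint written_nat c : seq nat :=
  match c with
  | CSkip | CSetR _ _ _ => [::]
  | CSetN a _ _ => [:: a]
  | CSeq c1 c2 | CIf _ c1 c2 => written_nat c1 ++ written_nat c2
  | CWhile _ c1 => written_nat c1
  end.

Fixpoint written_real c : seq nat :=
  match c with
  | CSkip | CSetN _ _ _ => [::]
  | CSetR a _ _ => [:: a]
  | CSeq c1 c2 | CIf _ c1 c2 => written_real c1 ++ written_real c2
  | CWhile _ c1 => written_real c1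
  end.

Definition framed c s s' :=
  (forall a, a \notin written_nat c -> nmem s' a = nmem s a) /\
  (forall a, a \notin written_real c -> rmem s' a = rmem s a).

Lemma framed_trans c s1 s2 s3 : framed c s1 s2 -> framed c s2 s3 -> framed c s1 s3.
Proof.
by move=> [n1 r1] [n2 r2]; split=> a Ha; rewrite ?n2 ?r2 // ?n1 ?r1.
Qed.

Lemma framed_sub c c' s s' :
  {subset written_nat c' <= written_nat c} ->
  {subset written_real c' <= written_real c} ->
  framed c' s s' -> framed c s s'.
Proof.
move=> sn sr [n r]; split=> a Ha; [apply: n | apply: r].
  by apply: contra Ha; apply: sn.
by apply: contra Ha; apply: sr.
Qed.

Lemma exec_framed c s t s' : exec c s t s' -> framed c s s'.
Proof.
elim=> {c s t s'} //=.
- by move=> s a i e; split=> // b /=; rewrite inE => /negPf ba; apply: funext => j;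
  rewrite /upd ba.
- by move=> s a i e; split=> // b /=; rewrite inE => /negPf ba; apply: funext => j;
  rewrite /upd ba.
- move=> c1 c2 s s1 s2 t1 t2 _ f1 _ f2.
  apply: (framed_trans (s2 := s1)).
    by apply: framed_sub f1 => a /= Ha; rewrite mem_cat Ha.
  by apply: framed_sub f2 => a /= Ha; rewrite mem_cat Ha orbT.
- move=> b c1 c2 s s1 t _ _; apply: framed_sub => a /= Ha; by rewrite mem_cat Ha.
- move=> b c1 c2 s s1 t _ _; apply: framed_sub => a /= Ha; by rewrite mem_cat Ha orbT.
- by move=> b c s s1 s2 t1 t2 _ _ f1 _ f2; exact: framed_trans f1 f2.
Qed.

Definition runs c s (T : nat) Q :=
  exists t s', [/\ exec c s t s', (t <= T)%N & Q s'].

(** Invariants need not mention arrays that a command does not write: their preservation is read off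
    the syntax. *)
Lemma runs_frame c s T Q : runs c s T (fun s' => framed c s s' -> Q s') -> runs c s T Q.
Proof.
by move=> [t [s' [e tT H]]]; exists t, s'; split=> //; apply/H/(exec_framed e).
Qed.

Lemma runs_weaken c s T T' Q Q' :
  (T <= T')%N -> (forall s', Q s' -> Q' s') -> runs c s T Q -> runs c s T' Q'.
Proof.
move=> TT QQ [t [s' [e tT H]]]; exists t, s'; split=> //; last exact: QQ.
exact: leq_trans TT.
Qed.

Lemma runs_seq c1 c2 s T1 T2 T Q :
  (T1 + T2 <= T)%N ->
  runs c1 s T1 (fun s1 => runs c2 s1 T2 Q) -> runs (CSeq c1 c2) s T Q.
Proof.
move=> TT [t1 [s1 [e1 h1 [t2 [s2 [e2 h2 q]]]]]].
exists (t1 + t2)%N, s2; split=> //; first exact: ExecSeq e1 e2.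
by apply: leq_trans TT; exact: leq_add.
Qed.

Lemma runs_skip s T Q : Q s -> runs CSkip s T Q.
Proof. by move=> q; exists 0%N, s; split=> //; exact: ExecSkip. Qed.

Lemma runs_setN s a i e (T : nat) Q : (0 < T)%N ->
  Q (State (upd (nmem s) a (neval s i) (neval s e)) (rmem s)) ->
  runs (CSetN a i e) s T Q.
Proof.
by move=> T0 q; exists 1%N; eexists; split; [exact: ExecSetN| |exact: q].
Qed.

Lemma runs_setR s a i e (T : nat) Q : (0 < T)%N ->
  Q (State (nmem s) (upd (rmem s) a (neval s i) (reval s e))) ->
  runs (CSetR a i e) s T Q.
Proof.
by move=> T0 q; exists 1%N; eexists; split; [exact: ExecSetR| |exact: q].
Qed.

Lemma runs_if b c1 c2 s T Q :
  (beval s b -> runs c1 s T Q) -> (~~ beval s b -> runs c2 s T Q) ->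
  runs (CIf b c1 c2) s T.+1 Q.
Proof.
move=> h1 h2; have [hb|hb] := boolP (beval s b).
  have [t [s' [e tT q]]] := h1 hb.
  by exists t.+1, s'; split=> //; exact: ExecIfT e.
have [t [s' [e tT q]]] := h2 hb.
by exists t.+1, s'; split=> //; exact: ExecIfF e.
Qed.

Lemma runs_while b c s n T (Inv : nat -> state R -> Prop) :
  Inv 0%N s ->
  (forall j s', (j < n)%N -> framed c s s' -> Inv j s' ->
     beval s' b /\ runs c s' T (Inv j.+1)) ->
  (forall s', framed c s s' -> Inv n s' -> ~~ beval s' b) ->
  runs (CWhile b c) s (n * T.+1).+1 (Inv n).
Proof.
move=> I0 step stop.
suff H d j s' : (n - j = d)%N -> (j <= n)%N -> framed c s s' -> Inv j s' ->
    runs (CWhile b c) s' (d * T.+1).+1 (Inv n).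
  by apply: (H n 0%N s) => //; rewrite subn0.
elim: d j s' => [|d IH] j s' e jn fr I.
  have jE : j = n by lia.
  subst j; exists 1%N, s'; split=> //.
  by apply: ExecWhileF; exact: stop.
have [bt [t1 [s1 [e1 h1 q1]]]] := step j s' (ltac:(lia)) fr I.
have fr1 : framed c s s1 := framed_trans fr (exec_framed e1).
have [t2 [s2 [e2 h2 q2]]] := IH j.+1 s1 (ltac:(lia)) (ltac:(lia)) fr1 q1.
exists (t1 + t2).+1, s2; split=> //; first exact: ExecWhileT e1 e2.
by rewrite mulSn; lia.
Qed.

Definition reg (a : nat) : nexp := NGet a (NConst 0).

Definition set_reg (a : nat) (e : nexp) : cmd := CSetN a (NConst 0) e.

(** The test is a parameter because one loop is bounded by a real entry of the matrix instead of a
    natural number. *)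
Definition for_loop (a : nat) (b : bexp) (c : cmd) : cmd :=
  CSeq (set_reg a (NConst 0))
       (CWhile b (CSeq c (set_reg a (NAdd (reg a) (NConst 1))))).

(** The invariant must hold for any content of the counter cell, so it depends on the index [j]
    alone. A round costs the body, an increment and a test; the final 2 is the initialisation and
    the last test. *)
Lemma runs_for a b c s n T (Inv : nat -> state R -> Prop) :
  a \notin written_nat c ->
  (forall s', framed (for_loop a b c) s s' -> beval s' b = (nmem s' a 0 < n)%N) ->
  (forall s', framed (set_reg a (NConst 0)) s s' -> Inv 0%N s') ->
  (forall j s', (j < n)%N -> framed (for_loop a b c) s s' -> nmem s' a 0 = j ->
     Inv j s' ->
     runs c s' T (fun s'' => forall v, Inv j.+1 (State (upd (nmem s'') a 0 v) (rmem
       s'')))) ->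
  runs (for_loop a b c) s (n * T.+2 + 2) (Inv n).
Proof.
move=> ac test init step.
apply: (runs_seq (T1 := 1) (T2 := (n * T.+2).+1)); first by rewrite add1n addn2.
apply: runs_frame; apply: runs_setN => //= fr0.
set s0 := State _ _.
have fr0' : framed (for_loop a b c) s s0.
  by apply: framed_sub fr0 => d //=; rewrite !inE => ->.
pose J j s' := Inv j s' /\ nmem s' a 0 = j.
apply: (runs_weaken (T := (n * T.+2).+1) (Q := J n)) => //; first by move=> s' [].
have frs s' : framed (CSeq c (set_reg a (NAdd (reg a) (NConst 1)))) s0 s' ->
    framed (for_loop a b c) s s'.
  move=> fr; apply: framed_trans fr0' _; apply: framed_sub fr => d //=.
  by rewrite !(mem_cat, inE); case: (d == a); case: (d \in _).
apply: runs_while => [|j s' jn /frs fr [I aj]|s' /frs fr [_ an]].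
- by split; [exact: init | rewrite /= /upd !eqxx].
- split; first by rewrite test // aj.
  apply: (runs_seq (T1 := T) (T2 := 1)); first by rewrite addn1.
  have [t [s'' [e tT q]]] := step j s' jn fr aj I.
  exists t, s''; split=> //; apply: runs_setN => //=; split; first exact: q.
  by rewrite /upd /= !eqxx /= (exec_framed e).1 // aj addn1.
- by rewrite test // an ltnn.
Qed.

Lemma runs_map p N a c s T (f : nat -> R) :
  p \notin written_nat c ->
  (forall s', framed (for_loop p (BNot (BLeN N (reg p))) c) s s' ->
     neval s' N = neval s N) ->
  (forall s', (nmem s' p 0 < neval s N)%N ->
     framed (for_loop p (BNot (BLeN N (reg p))) c) s s' ->
     (forall q, rmem s' a q = if (q < nmem s' p 0)%N then f q else rmem s a q) ->
     runs c s' T (fun s'' => forall q,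
       rmem s'' a q = if q == nmem s' p 0 then f q else rmem s' a q)) ->
  a \in written_real c ->
  runs (for_loop p (BNot (BLeN N (reg p))) c) s (neval s N * T.+2 + 2)
    (fun s' => forall q, rmem s' a q = if (q < neval s N)%N then f q else rmem s a q).
Proof.
move=> pc NE step ac.
apply: (runs_for (Inv := fun j s' => forall q,
   rmem s' a q = if (q < j)%N then f q else rmem s a q)) => //.
- by move=> s' fr /=; rewrite NE // -ltnNge.
- by move=> s' [_ fr] q; rewrite fr.
- move=> j s' jn fr pj I.
  have := step s'; rewrite pj => /(_ jn fr I).
  apply: runs_weaken => // s'' H v q /=; rewrite H I (ltnS q j).
  by have [->|/negPf qj] := eqVneq q j; rewrite ?leqnn // (leq_eqVlt q j) qj.
Qed.

End Hoare.

(** * The program, and the functions it computes on flat arrays *)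

Section Program.

(* Registers: 1 = D * D, 2 and 3 = positions in the grid, 4 = row of the
   block, 5 = current row of the matrix, 6 = offset of that row, 7 and 8 =
   offsets of the weight row and the parent row.  Real arrays: 3 = masses
   allocated so far, 4 = estimates, 5 = truncated estimates, 6 and 7 = sums. *)
Definition below (i n : nexp) : bexp := BNot (BLeN n i).

(** The minimum over buckets starts at 1, which bounds every cell mass of a distribution. *)
Definition init_est : cmd :=
  for_loop 2 (below (reg 2) (reg 1)) (CSetR 4 (reg 2) (RNat (NConst 1))).

Definition est_row : cmd :=
  for_loop 2 (below (reg 2) (reg 1))
    (CIf (BLeR (RGet 1 (NAdd (reg 6) (reg 2))) (RNat (NConst 0))) CSkip
      (CIf (BLeR (RGet 4 (reg 2)) (RGet 2 (reg 5))) CSkip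
        (CSetR 4 (reg 2) (RGet 2 (reg 5))))).

(** The number of hash rows per level is not part of the input; it is read from entry 1 of the
    matrix. *)
Definition est_block : cmd :=
  for_loop 4 (BNot (BLeR (RGet 1 (NConst 1)) (RNat (reg 4))))
    (CSeq est_row
      (CSeq (set_reg 6 (NAdd (reg 6) (reg 1)))
            (set_reg 5 (NAdd (reg 5) (NConst 1))))).

Definition select_top : cmd :=
  for_loop 2 (below (reg 2) (reg 1))
    (CSeq (CSetR 7 (NConst 0) (RNat (NConst 0)))
    (CSeq (for_loop 3 (below (reg 3) (reg 1))
            (CIf (BLeR (RGet 4 (reg 2)) (RGet 4 (reg 3)))
              (CSetR 7 (NConst 0)
                (RAdd (RGet 7 (NConst 0)) (RGet 1 (NAdd (reg 7) (reg 3)))))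
              CSkip))
    (CIf (BLeR (RGet 7 (NConst 0)) (RGet 1 (NConst 0)))
      (CSetR 5 (reg 2) (RGet 4 (reg 2)))
      (CSetR 5 (reg 2) (RNat (NConst 0)))))).

(** Updating array 3 in place is safe: the sums read only arrays 1 and 5, and a point reads only its
    own entry of array 3. The two nested comparisons test equality of parents. *)
Definition split_level : cmd :=
  for_loop 2 (below (reg 2) (reg 1))
    (CSeq (CSetR 6 (NConst 0) (RNat (NConst 0)))
    (CSeq (CSetR 7 (NConst 0) (RNat (NConst 0)))
    (CSeq (for_loop 3 (below (reg 3) (reg 1))
            (CIf (BLeR (RGet 1 (NAdd (reg 8) (reg 3))) (RGet 1 (NAdd (reg 8) (reg 2))))
              (CIf (BLeR (RGet 1 (NAdd (reg 8) (reg 2))) (RGet 1 (NAdd (reg 8) (reg 3))))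
                (CSeq
                  (CSetR 6 (NConst 0) (RAdd (RGet 6 (NConst 0))
                    (RMul (RGet 1 (NAdd (reg 7) (reg 3))) (RGet 5 (reg 3)))))
                  (CSetR 7 (NConst 0) (RAdd (RGet 7 (NConst 0))
                    (RGet 1 (NAdd (reg 7) (reg 3))))))
                CSkip)
              CSkip))
    (CIf (BLeR (RGet 6 (NConst 0)) (RNat (NConst 0)))
      (CSetR 3 (reg 2) (RDiv (RGet 3 (reg 2)) (RGet 7 (NConst 0))))
      (CSetR 3 (reg 2)
        (RDiv (RMul (RGet 3 (reg 2)) (RGet 5 (reg 2))) (RGet 6 (NConst 0)))))))).

Definition level_cmd : cmd :=
  CSeq (set_reg 7 (reg 6))
  (CSeq (set_reg 8 (NAdd (reg 6) (reg 1)))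
  (CSeq (set_reg 6 (NAdd (NAdd (reg 6) (reg 1)) (reg 1)))
  (CSeq (set_reg 5 (NAdd (reg 5) (NConst 2)))
  (CSeq init_est (CSeq est_block (CSeq select_top split_level)))))).

(** [D * D] is obtained by repeated addition, natural numbers having no product. The number of
    levels is not stored anywhere; the outer loop stops when the rows are used up. *)
Definition emd_prog : cmd :=
  CSeq (set_reg 1 (NConst 0))
  (CSeq (for_loop 2 (below (reg 2) (NGet 0 (NConst 0)))
          (set_reg 1 (NAdd (reg 1) (NGet 0 (NConst 0)))))
  (CSeq (for_loop 2 (below (reg 2) (reg 1)) (CSetR 3 (reg 2) (RNat (NConst 1))))
  (CSeq (set_reg 6 (reg 1))
  (CSeq (set_reg 5 (NConst 1))
  (CWhile (below (reg 5) (NGet 0 (NConst 2))) level_cmd))))).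

Context {R : realType}.
Implicit Types (A y est b X : nat -> R) (N : nat) (s : state R).

(** This and the following [_flat] functions describe the contents of the arrays. They separate the
    correctness of the program, which holds for arbitrary contents of the hash rows, from the error
    analysis. *)
Fixpoint est_rows A y N base r t p : R :=
  if t is t'.+1 then
    let e := est_rows A y N base r t' p in
    if A (base + t' * N + p)%N <= 0 then e
    else if e <= y (r + t')%N then e else y (r + t')%N
  else 1.

Definition top_flat A N W est p : R :=
  if \sum_(q < N) (if est p <= est q then A (W + q)%N else 0) <= A 0%N
  then est p else 0.

Definition same_parent A P p q := A (P + q)%N == A (P + p)%N.

Definition split_flat A N W P b X p : R :=
  let s := \sum_(q < N) (if same_parent A P p q then A (W + q)%N * b q else 0) in
  if s <= 0 then
    X p / \sum_(q < N) (if same_parent A P p q then A (W + q)%N else 0)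
  else X p * b p / s.

Definition level_flat A y N RB r X : nat -> R :=
  split_flat A N (r * N) (r * N + N)
    (top_flat A N (r * N) (est_rows A y N (r * N + N + N) (r + 2) RB)) X.

Fixpoint levels_flat A y N RB j : nat -> R :=
  if j is j'.+1 then level_flat A y N RB (1 + j' * (RB + 2)) (levels_flat A y N RB j')
  else fun=> 1.

Lemma runs_init_est s :
  runs init_est s (nmem s 1 0 * 3 + 2)
    (fun s' => forall q, (q < nmem s 1 0)%N -> rmem s' 4 q = 1).
Proof.
apply: runs_weaken (runs_map (a := 4) (T := 1) (f := fun=> 1) _ _ _ _) => //.
- by move=> s' H q qN; rewrite H qN.
- by move=> s' [fr _] /=; rewrite fr.
- by move=> s' _ _ _; apply: runs_setR => //= q; rewrite /upd /=.
Qed.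

Lemma runs_est_row s A y base r :
  rmem s 1 = A -> rmem s 2 = y -> nmem s 6 0 = base -> nmem s 5 0 = r ->
  runs est_row s (nmem s 1 0 * 5 + 2) (fun s' => forall q, rmem s' 4 q =
    if (q < nmem s 1 0)%N then
      if A (base + q)%N <= 0 then rmem s 4 q
      else if rmem s 4 q <= y r then rmem s 4 q else y r
    else rmem s 4 q).
Proof.
move=> sA sy sb sr; apply: runs_map => //.
- by move=> s' [fr _] /=; rewrite fr.
- move=> s' pN fr I.
  have eA : rmem s' 1 = A by rewrite fr.2.
  have ey : rmem s' 2 = y by rewrite fr.2.
  have eb : nmem s' 6 0 = base by rewrite fr.1.
  have er : nmem s' 5 0 = r by rewrite fr.1.
  have ee : rmem s' 4 (nmem s' 2 0) = rmem s 4 (nmem s' 2 0) by rewrite I ltnn.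
  apply: runs_if => /=; rewrite eA eb => hA.
    apply: runs_skip => q; have [->|//] := eqVneq q; by rewrite hA.
  apply: runs_if => /=; rewrite ee ey er => hy.
    apply: runs_skip => q; have [->|//] := eqVneq q; by rewrite (negPf hA) hy.
  apply: runs_setR => //= q; rewrite /upd /=; have [->|//] := eqVneq q.
  by rewrite (negPf hA) (negPf hy) ey er.
Qed.

Lemma runs_est_block s A y N base r RB :
  rmem s 1 = A -> rmem s 2 = y -> A 1%N = RB%:R -> nmem s 1 0 = N ->
  nmem s 6 0 = base -> nmem s 5 0 = r ->
  (forall q, (q < N)%N -> rmem s 4 q = 1) ->
  runs est_block s (RB * (N * 5 + 6) + 2) (fun s' =>
    [/\ forall q, (q < N)%N -> rmem s' 4 q = est_rows A y N base r RB q,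
        nmem s' 6 0 = (base + RB * N)%N & nmem s' 5 0 = (r + RB)%N]).
Proof.
move=> sA sy AR sN sb sr s1.
apply: runs_weaken (runs_for (n := RB) (T := N * 5 + 4) (Inv := fun j s' =>
    [/\ forall q, (q < N)%N -> rmem s' 4 q = est_rows A y N base r j q,
        nmem s' 6 0 = (base + j * N)%N & nmem s' 5 0 = (r + j)%N]) _ _ _ _) => //.
- by rewrite -addn2 -!addnA.
- by move=> s' fr /=; rewrite fr.2 // sA AR ler_nat ltnNge.
- by move=> s' fr; rewrite !fr.1 // fr.2 // addn0 addn0.
move=> j s' jR fr _ [I4 I6 I5].
have eN : nmem s' 1 0 = N by rewrite fr.1.
have eA : rmem s' 1 = A by rewrite fr.2.
have ey : rmem s' 2 = y by rewrite fr.2.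
apply: (runs_seq (T1 := N * 5 + 2) (T2 := 2)); first by rewrite -addnA.
apply: runs_frame; rewrite -eN.
apply: runs_weaken (runs_est_row eA ey I6 I5) => // s1' H fr1.
apply: (runs_seq (T1 := 1) (T2 := 1)) => //.
apply: runs_setN => //=; apply: runs_setN => //= v; split=> [q qN||].
- by rewrite eN in qN; rewrite /upd /= H eN qN !I4.
- by rewrite /upd /= !fr1.1 // I6 eN mulSn; lia.
- by rewrite /upd /= !fr1.1 // I5 addn1 addnS.
Qed.

Lemma runs_select_top s A W N est :
  rmem s 1 = A -> nmem s 1 0 = N -> nmem s 7 0 = W ->
  (forall q, (q < N)%N -> rmem s 4 q = est q) ->
  runs select_top s (N * (N * 4 + 7) + 2) (fun s' =>
    forall q, (q < N)%N -> rmem s' 5 q = top_flat A N W est q).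
Proof.
move=> sA sN sW se.
have NE : neval s (reg 1) = N by [].
apply: runs_weaken (runs_map (a := 5) (T := N * 4 + 5) (f := top_flat A N W est) _ _ _ _)
  => //.
- by rewrite NE -addn2 -!addnA.
- by move=> s' H q qN; rewrite H NE qN.
- by move=> s' [fr _] /=; rewrite fr.
move=> s' pN fr _; rewrite NE in pN.
apply: (runs_seq (T1 := 1) (T2 := N * 4 + 4)); first by rewrite addnC -addnA.
apply: runs_frame; apply: runs_setR => //= fr1; set s1 := State _ _.
apply: (runs_seq (T1 := N * 4 + 2) (T2 := 2)); first by rewrite -addnA.
set p := nmem s' 2 0.
apply: runs_frame.
apply: runs_weaken (runs_for (n := N) (T := 2) (Inv := fun j v =>
    rmem v 7 0 = \sum_(q < j) (if est p <= est q then A (W + q)%N else 0)) _ _ _ _) => //.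
- move=> v Hv fr2.
  have p2 : nmem v 2 0 = p by rewrite fr2.1.
  have e4 : rmem v 4 = rmem s 4 by rewrite fr2.2 // -(fr.2 4).
  have eA : rmem v 1 = A by rewrite fr2.2 // -sA -(fr.2 1).
  have e5 : rmem v 5 = rmem s' 5 by rewrite fr2.2.
  rewrite /top_flat; apply: runs_if => /=; rewrite Hv eA => hk.
    apply: runs_setR => //= q; rewrite /upd p2 e4 e5 /=; have [->|//] := eqVneq q p.
    by rewrite se // hk.
  apply: runs_setR => //= q; rewrite /upd p2 e5 /=; have [->|//] := eqVneq q p.
  by rewrite (negPf hk).
- move=> v fr2 /=; rewrite -ltnNge (_ : nmem v 1 0 = N) //.
  by rewrite fr2.1 // -sN -(fr.1 1).
- by move=> v fr2; rewrite fr2.2 //= /upd /= big_ord0.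
move=> j v jN fr2 vj I.
have p2 : nmem v 2 0 = p by rewrite fr2.1.
have e4 : rmem v 4 = rmem s 4 by rewrite fr2.2 // -(fr.2 4).
have eA : rmem v 1 = A by rewrite fr2.2 // -sA -(fr.2 1).
have eW' : nmem v 7 0 = W by rewrite fr2.1 // -sW -(fr.1 7).
apply: runs_if => /=; rewrite p2 vj e4 !se // => h.
  apply: runs_setR => //= _; rewrite /upd /= big_ord_recr /= h I eA eW' vj //.
by apply: runs_skip => _ /=; rewrite big_ord_recr /= (negPf h) addr0.
Qed.

Lemma runs_split_level s A W P N b X :
  rmem s 1 = A -> nmem s 1 0 = N -> nmem s 7 0 = W -> nmem s 8 0 = P ->
  (forall q, (q < N)%N -> rmem s 5 q = b q) ->
  (forall q, (q < N)%N -> rmem s 3 q = X q) ->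
  runs split_level s (N * (N * 6 + 8) + 2) (fun s' =>
    forall q, (q < N)%N -> rmem s' 3 q = split_flat A N W P b X q).
Proof.
move=> sA sN sW sP sb sX.
have NE : neval s (reg 1) = N by [].
apply: runs_weaken (runs_map (a := 3) (T := N * 6 + 6) (f := split_flat A N W P b X) _ _
  _ _) => //.
- by rewrite NE -addn2 -!addnA.
- by move=> s' H q qN; rewrite H NE qN.
- by move=> s' [fr _] /=; rewrite fr.
move=> s' pN fr I3; rewrite NE in pN.
apply: (runs_seq (T1 := 1) (T2 := N * 6 + 5)); first by rewrite addnC -addnA.
apply: runs_frame; apply: runs_setR => //= fr1; set s1 := State _ _.
apply: (runs_seq (T1 := 1) (T2 := N * 6 + 4)); first by rewrite addnC -addnA.
apply: runs_frame; apply: runs_setR => //= fr1'; set s2 := State _ _.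
apply: (runs_seq (T1 := N * 6 + 2) (T2 := 2)); first by rewrite -addnA.
set p := nmem s' 2 0.
have eX : rmem s' 3 p = X p by rewrite I3 ltnn sX.
apply: runs_frame.
apply: runs_weaken (runs_for (n := N) (T := 4) (Inv := fun j v =>
    rmem v 6 0 = \sum_(q < j) (if same_parent A P p q then A (W + q)%N * b q else 0) /\
    rmem v 7 0 = \sum_(q < j) (if same_parent A P p q then A (W + q)%N else 0)) _ _ _ _)
      => //.
- move=> v [H6 H7] fr2.
  have p2 : nmem v 2 0 = p by rewrite fr2.1.
  have e3 : rmem v 3 = rmem s' 3 by rewrite fr2.2.
  have e5 : rmem v 5 = rmem s 5 by rewrite fr2.2 // -(fr.2 5).
  rewrite /split_flat; apply: runs_if => /=; rewrite H6 => hk.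
    apply: runs_setR => //= q; rewrite /upd p2 e3 H7 eX /=; have [->|//] := eqVneq q p.
    by rewrite hk.
  apply: runs_setR => //= q; rewrite /upd p2 e3 e5 H6 eX /=; have [->|//] := eqVneq q p.
  by rewrite (negPf hk) sb.
- move=> v fr2 /=; rewrite -ltnNge (_ : nmem v 1 0 = N) //.
  by rewrite fr2.1 // -sN -(fr.1 1).
- by move=> v fr2; rewrite !fr2.2 //= /upd /= !big_ord0.
move=> j v jN fr2 vj [I6 I7].
have p2 : nmem v 2 0 = p by rewrite fr2.1.
have e5 : rmem v 5 = rmem s 5 by rewrite fr2.2 // -(fr.2 5).
have eA : rmem v 1 = A by rewrite fr2.2 // -sA -(fr.2 1).
have eW : nmem v 7 0 = W by rewrite fr2.1 // -sW -(fr.1 7).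
have eP : nmem v 8 0 = P by rewrite fr2.1 // -sP -(fr.1 8).
have no : ~~ same_parent A P p j -> runs CSkip v 2 (fun s'' => forall u,
    rmem (State (upd (nmem s'') 3 0 u) (rmem s'')) 6 0 =
       \sum_(q < j.+1) (if same_parent A P p q then A (W + q)%N * b q else 0) /\
    rmem (State (upd (nmem s'') 3 0 u) (rmem s'')) 7 0 =
       \sum_(q < j.+1) (if same_parent A P p q then A (W + q)%N else 0)).
  by move=> h; apply: runs_skip => _ /=; rewrite !big_ord_recr /= (negPf h) !addr0.
apply: runs_if => /=; rewrite p2 vj eA eP => h; last first.
  apply: runs_weaken (no _) => //; apply: contra h => /eqP ->; exact: lexx.
apply: runs_if => /=; rewrite p2 vj eA eP => h'; last first.
  by apply: no; apply: contra h' => /eqP ->; exact: lexx.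
have same : same_parent A P p j by rewrite /same_parent eq_le h h'.
apply: (runs_seq (T1 := 1) (T2 := 1)) => //.
apply: runs_setR => //=; apply: runs_setR => //= _.
by rewrite /upd /= !big_ord_recr /= same I6 I7 eA eW vj e5 sb.
Qed.

(** The first term pays for the hash rows. The second is quadratic in [N] because ranking and
    splitting compare all pairs of points. *)
Definition level_time N RB := (RB * (N * 5 + 6) + N * (N * 10 + 18) + 20)%N.

Lemma runs_level_cmd s A y N r RB X :
  rmem s 1 = A -> rmem s 2 = y -> A 1%N = RB%:R -> nmem s 1 0 = N ->
  nmem s 6 0 = (r * N)%N -> nmem s 5 0 = r ->
  (forall q, (q < N)%N -> rmem s 3 q = X q) ->
  runs level_cmd s (level_time N RB) (fun s' =>
    [/\ forall q, (q < N)%N -> rmem s' 3 q = level_flat A y N RB r X q,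
        nmem s' 6 0 = ((r + (RB + 2)) * N)%N & nmem s' 5 0 = (r + (RB + 2))%N]).
Proof.
move=> sA sy AR sN sb sr sX; rewrite /level_time.
pose TI := (N * 3 + 2)%N; pose TB := (RB * (N * 5 + 6) + 2)%N.
pose TS := (N * (N * 4 + 7) + 2)%N; pose TL := (N * (N * 6 + 8) + 2)%N.
apply: (runs_seq (T1 := 1) (T2 := 3 + (TI + (TB + (TS + TL)))));
  first by rewrite /TI /TB /TS /TL; lia.
apply: runs_setN => //=.
apply: (runs_seq (T1 := 1) (T2 := 2 + (TI + (TB + (TS + TL))))); first by lia.
apply: runs_setN => //=.
apply: (runs_seq (T1 := 1) (T2 := 1 + (TI + (TB + (TS + TL))))); first by lia.
apply: runs_setN => //=.
apply: (runs_seq (T1 := 1) (T2 := (TI + (TB + (TS + TL))))); first by lia.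
apply: runs_setN => //=.
set s0 := State _ _.
have s0_6 : nmem s0 6 0 = (r * N + N + N)%N by rewrite /s0 /= /upd /= sb sN.
have s0_5 : nmem s0 5 0 = (r + 2)%N by rewrite /s0 /= /upd /= sr.
have s0_7 : nmem s0 7 0 = (r * N)%N by rewrite /s0 /= /upd /= sb.
have s0_8 : nmem s0 8 0 = (r * N + N)%N by rewrite /s0 /= /upd /= sb sN.
have s0_1 : nmem s0 1 0 = N by rewrite /s0 /= /upd /= sN.
have s0A : rmem s0 1 = A by [].
have s0y : rmem s0 2 = y by [].
have s03 q : (q < N)%N -> rmem s0 3 q = X q by exact: sX.
move: s0 s0_6 s0_5 s0_7 s0_8 s0_1 s0A s0y s03 => s0 s0_6 s0_5 s0_7 s0_8 s0_1 s0A s0y s03.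
apply: (runs_seq (leqnn _)); apply: runs_frame.
rewrite /TI -s0_1; apply: runs_weaken (runs_init_est s0) => // s1 H1 f1.
rewrite s0_1 in H1 *.
apply: (runs_seq (leqnn _)); apply: runs_frame.
apply: runs_weaken (runs_est_block (y := y) (N := N) (base := r * N + N + N) (r := r + 2)
  _ _ AR _ _ _ H1) => //;
  rewrite ?f1.1 ?f1.2 // => s2 [H2 H2b H2r] f2.
apply: (runs_seq (leqnn _)); apply: runs_frame.
apply: runs_weaken (runs_select_top (A := A) (W := r * N) _ _ _ H2) => //;
  rewrite ?f2.1 ?f2.2 // ?f1.1 ?f1.2 // => s3 H3 f3.
apply: runs_frame.
apply: runs_weaken (runs_split_level (A := A) (W := r * N) (P := r * N + N) (X := X) _ _
  _ _ H3 _) => //;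
  rewrite ?f3.1 ?f3.2 // ?f2.1 ?f2.2 // ?f1.1 ?f1.2 // => s4 H4 f4.
rewrite !f4.1 // !f3.1 // H2b H2r; split=> [q qN||].
- exact: H4.
- by rewrite !mulnDl; lia.
- by lia.
Qed.

Lemma runs_emd_prog s A y D m nl RB :
  rmem s 1 = A -> rmem s 2 = y -> A 1%N = RB%:R ->
  nmem s 0 0 = D -> nmem s 0 2 = m -> m = (1 + nl * (RB + 2))%N ->
  runs emd_prog s (D * 3 + D * D * 3 + nl * (level_time (D * D) RB).+1 + 10) (fun s' =>
    forall q, (q < D * D)%N -> rmem s' 3 q = levels_flat A y (D * D) RB nl q).
Proof.
move=> sA sy AR sD sm mE; set N := (D * D)%N.
pose TL := (nl * (level_time N RB).+1).+1.
apply: (runs_seq (T1 := 1) (T2 := (D * 3 + 2) + ((N * 3 + 2) + (1 + (1 + TL))))).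
  by rewrite /TL; lia.
apply: runs_setN => //=; set s0 := State _ _.
apply: (runs_seq (leqnn _)); apply: runs_frame.
apply: runs_weaken (runs_for (n := D) (T := 1) (Inv := fun j v => nmem v 1 0 = j * D)%N _
  _ _ _) => //; last first.
- move=> j v jD fr _ I; apply: runs_setN => //= u.
  by rewrite /upd /= I fr.1 //= /upd /= sD mulSn addnC.
- by move=> v fr; rewrite fr.1 //= /upd /= mul0n.
- by move=> v fr /=; rewrite fr.1 //= /upd /= sD -ltnNge.
move=> s1 H1 f1.
apply: (runs_seq (leqnn _)); apply: runs_frame.
have e1 : neval s1 (reg 1) = N by [].
apply: runs_weaken (runs_map (a := 3) (T := 1) (f := fun=> 1) _ _ _ _) => //;
  first by rewrite e1.
- move=> s2 H2 f2; rewrite e1 in H2.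
  apply: (runs_seq (leqnn _)); apply: runs_setN => //=.
  apply: (runs_seq (leqnn _)); apply: runs_setN => //=; set s3 := State _ _.
  have s31 : nmem s3 1 0 = N by rewrite /s3 /= /upd /= f2.1.
  apply: runs_weaken (runs_while (n := nl) (T := level_time N RB) (Inv := fun j v =>
    [/\ forall q, (q < N)%N -> rmem v 3 q = levels_flat A y N RB j q,
        nmem v 6 0 = ((1 + j * (RB + 2)) * N)%N & nmem v 5 0 = (1 + j * (RB + 2))%N]) _ _
          _) => //.
  + by move=> v [].
  + split=> [q qN||] /=; rewrite /upd /=; first by rewrite H2 qN.
      by rewrite f2.1 // mul0n addn0 mul1n.
    by rewrite mul0n addn0.
  + move=> j v jn fr [I3 I6 I5].
    split; first by rewrite /= I5 fr.1 //= /upd /= f2.1 //= f1.1 //= /upd /= sm mE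
      -ltnNge ltn_add2l ltn_mul2r addnS jn.
    have vA : rmem v 1 = A by rewrite fr.2 //= f2.2 // f1.2.
    have vy : rmem v 2 = y by rewrite fr.2 //= f2.2 // f1.2.
    have vN : nmem v 1 0 = N by rewrite fr.1.
    apply: runs_weaken (runs_level_cmd vA vy AR vN I6 I5 I3) => // v' [J3 J6 J5].
    by rewrite mulSn; split=> //; rewrite ?J6 ?J5; lia.
  + move=> v fr [_ _ I5].
    by rewrite /= I5 fr.1 //= /upd /= f2.1 //= f1.1 //= /upd /= sm mE leqnn.
- by move=> s' [fr _] /=; rewrite fr.
- by move=> s' _ _ _; apply: runs_setR => //= q; rewrite /upd /=.
Qed.

End Program.

(** * The sketching scheme *)

Section UniformNat.
Context {R : realType} (n : nat).

(** A uniform measure on 0, ..., n is placed on [nat], whose discrete sigma-algebra makes every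
    function measurable. *)
Definition uniform_nat : set nat -> \bar R :=
  msum (fun j => mscale ((n.+1%:R^-1 : R)%:nng) (\d_j)) n.+1.

HB.instance Definition _ := Measure.on uniform_nat.

Lemma uniform_natE (A : set nat) :
  uniform_nat A = (\sum_(j < n.+1) (n.+1%:R^-1 * \1_A (j : nat)))%:E.
Proof.
rewrite /uniform_nat /msum -sumEFin; apply: eq_bigr => j _.
by rewrite EFinM.
Qed.

Lemma uniform_nat_setT : uniform_nat setT = 1%E.
Proof.
rewrite uniform_natE (eq_bigr (fun=> n.+1%:R^-1)); last first.
  by move=> j _; rewrite indicT mulr1.
by rewrite sumr_const card_ord -[_^-1 *+ _]mulr_natl divff // pnatr_eq0.
Qed.

HB.instance Definition _ :=
  Measure_isProbability.Build _ _ R uniform_nat uniform_nat_setT.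

Lemma measurable_fun_nat (f : nat -> R) : measurable_fun [set: nat] f.
Proof. by []. Qed.

End UniformNat.

Section FiniteScheme.
Context {R : realType} {D m : nat} {W : finType} (w0 : W).
Variable entry : W -> 'I_m -> grid D -> R.
Variable recover : ('I_m -> grid D -> R) -> ('I_m -> R) -> grid D -> R.

(** Indices outside the enumeration, which have probability zero, decode to [w0], so the time bound,
    which ranges over all indices, covers them too. *)
Definition decode (j : nat) : W := nth w0 (enum W) j.

Definition uniform_W : probability nat R := @uniform_nat R #|W|.-1.

Definition coded_entry (r : 'I_m) (p : grid D) (j : nat) : R := entry (decode j) r p.

HB.instance Definition _ r p :=
  isMeasurableFun.Build _ _ nat R (coded_entry r p)
    (measurable_fun_nat (coded_entry r p)).

Definition finite_scheme : sketching_scheme R D m :=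
  @SketchingScheme R D m _ nat uniform_W
    (fun r p => coded_entry r p) recover.

Lemma holds_with_prob_finite (q : R) (good : pred W)
    (event : scheme_space finite_scheme -> Prop) :
  q * #|W|%:R <= #|[pred w | good w]|%:R ->
  (forall j, good (decode j) -> event j) ->
  holds_with_prob q event.
Proof.
move=> hq hgood; exists [set j : nat | good (decode j)]; split=> //.
have W0 : (0 < #|W|)%N by apply/card_gt0P; exists w0.
rewrite /= /uniform_W /= uniform_natE lee_fin prednK //.
rewrite -mulr_sumr ler_pdivlMl ?ltr0n // mulrC (le_trans hq) //.
have -> : #|[pred w | good w]|%:R = \sum_(j < #|W|) (good (decode j))%:R :> R.
  rewrite -sum1_card natr_sum big_mkcond /= -big_enum /=.
  rewrite (big_nth w0) -cardE big_mkord; apply: eq_bigr => j _.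
  by rewrite /decode inE; case: (good _).
apply: ler_sum => j _; rewrite indicE ler_nat.
by case: (boolP (good (decode j))) => // hj; rewrite mem_set.
Qed.

End FiniteScheme.

(** * Row-major layout of grid and matrix *)

Section Layout.
Context {R : realType} {D : nat}.
Implicit Types (p q : grid D).

Definition flat p : nat := (p.1 * D + p.2)%N.

Lemma mulnD_inj a b u v : (u < D)%N -> (v < D)%N ->
  (a * D + u = b * D + v)%N -> a = b /\ u = v.
Proof.
move=> uD vD e; have D0 : (0 < D)%N by exact: leq_ltn_trans uD.
have := congr1 (fun i => i %/ D)%N e; have := congr1 (fun i => i %% D)%N e.
by rewrite !modnMDl !modn_small // !divnMDl // !divn_small // !addn0.
Qed.

Lemma flat_inj : injective flat.
Proof.
move=> [p1 p2] [q1 q2] /mulnD_inj /= [] // e1 e2.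
by congr pair; apply: val_inj.
Qed.

Lemma flat_lt p : (flat p < D * D)%N.
Proof.
rewrite /flat; have := ltn_ord p.1; have := ltn_ord p.2.
by case: p => [[i hi] [j hj]] /= _ _; nia.
Qed.

Lemma sum_flat (g : nat -> R) : \sum_(q < D * D) g q = \sum_(p : grid D) g (flat p).
Proof.
pose f p : 'I_(D * D) := Ordinal (flat_lt p).
have fI : injective f by move=> p q /(congr1 val) /flat_inj.
have fB : bijective f by apply: inj_card_bij fI _; rewrite card_prod !card_ord.
by rewrite (reindex f) //; exact: onW_bij.
Qed.

(** Row-major indices are distinct, so a single term of the sum defining the memory cell
    survives. *)
Lemma load_realA m lam (A : 'I_m -> grid D -> R) y (r : 'I_m) p :
  load_real lam A y 1 (r * (D * D) + flat p) = A r p.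
Proof.
rewrite /load_real (bigD1 r) //= (bigD1 p) //=.
rewrite (_ : _ == _ = true); last by apply/eqP; rewrite /flat; ring.
rewrite big1 => [|q qp]; last first.
  case: eqP => // e; case/negP: qp; apply/eqP/flat_inj.
  move: e; rewrite /flat mulnA => e.
  have {}e : ((r * D + p.1) * D + p.2 = (r * D + q.1) * D + q.2)%N by rewrite -e; ring.
  have [e1 e2] := mulnD_inj (ltn_ord _) (ltn_ord _) e.
  by move/addnI: e1 => ->; rewrite e2.
rewrite big1 ?addr0 // => s sr; rewrite big1 // => q _.
case: eqP => // e; case/negP: sr; apply/eqP/val_inj => /=.
have {}e : ((r * D + p.1) * D + p.2 = (s * D + q.1) * D + q.2)%N by rewrite -e /flat; ring.
have [e1 _] := mulnD_inj (ltn_ord _) (ltn_ord _) e.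
by have [] := mulnD_inj (ltn_ord _) (ltn_ord _) e1.
Qed.

Lemma load_realy m lam (A : 'I_m -> grid D -> R) y (r : 'I_m) :
  load_real lam A y 2 r = y r.
Proof.
rewrite /load_real (bigD1 r) //= eqxx big1 ?addr0 // => s sr.
by rewrite eq_sym; case: eqP => // /val_inj e; rewrite e eqxx in sr.
Qed.

End Layout.

(** * Count-min estimates; row [t] is bucket [t %% B] of repetition [t %/ B] *)

Section Estimates.
Context {R : realType} {D : nat}.
Variables (A y : nat -> R) (base r B reps i : nat) (h : nat -> grid D -> nat).
Variable x : grid D -> R.
Hypothesis x0 : forall p, 0 <= x p.
Hypothesis x1 : \sum_p x p = 1.
Hypothesis B0 : (0 < B)%N.
Hypothesis AE : forall t p, (t < reps * B)%N ->
  A (base + t * (D * D) + flat p)%N = (h (t %/ B)%N (cell i p) == (t %% B)%N)%:R.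
Hypothesis yE : forall t, (t < reps * B)%N ->
  y (r + t)%N = \sum_(q | h (t %/ B)%N (cell i q) == (t %% B)%N) x q.

Local Notation est t p := (est_rows A y (D * D) base r t%N (flat p)).

Let estS t p : (t < reps * B)%N -> est t.+1 p =
  if h (t %/ B)%N (cell i p) == (t %% B)%N then Num.min (est t p) (y (r + t)%N)
  else est t p.
Proof.
move=> tB; rewrite /= AE //; case: (h _ _ == _); rewrite ?lexx //.
by rewrite ler10 minEle.
Qed.

(** A bucket that contains the cell holds all its mass plus nonnegative noise, and the initial value
    1 is the total mass. *)
Lemma est_rows_ge t (p : grid D) : (t <= reps * B)%N -> cellsum (cell i) x p <= est t p.
Proof.
elim: t => [|t IH] tB.
  rewrite /= -x1 /cellsum [leLHS]big_mkcond ler_sum //= => q _.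
  by case: ifP.
rewrite estS //; case: ifPn => [/eqP e|_]; last by rewrite IH // ltnW.
rewrite le_min IH ?(ltnW tB) //= yE // -e.
rewrite (bucket_mass (cell i) (h (t %/ B)%N) x p) lerDl.
by apply: sumr_ge0.
Qed.

Lemma est_rows_cell t (p q : grid D) : (t <= reps * B)%N -> cell i p = cell i q ->
  est t p = est t q.
Proof.
move=> tB pq; elim: t tB => [//|t IH] tB.
by rewrite !estS // pq IH // ltnW.
Qed.

(** The row of the cell's own bucket in repetition [s] caps the estimate, and later rows can only
    lower it. *)
Lemma est_rows_le_bucket s (p : grid D) : (s < reps)%N -> (forall c, h s c < B)%N ->
  est (reps * B)%N p <= cellsum (cell i) x p + noise (cell i) (h s) x p.
Proof.
move=> sr hB; rewrite -bucket_mass.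
pose t := (s * B + h s (cell i p))%N.
have tB : (t < reps * B)%N.
  have : (s.+1 * B <= reps * B)%N by rewrite leq_mul2r sr orbT.
  by rewrite mulSn /t; have := hB (cell i p); lia.
have ts : (t %/ B = s)%N by rewrite /t divnMDl // divn_small // addn0.
have tm : (t %% B = h s (cell i p))%N by rewrite /t modnMDl modn_small.
suff H u : (t < u)%N -> (u <= reps * B)%N ->
    est u p <= \sum_(q | h s (cell i q) == h s (cell i p)) x q by exact: H.
elim: u => [//|u IH]; rewrite ltnS leq_eqVlt => /orP[/eqP <-|tu] uB.
  by rewrite estS // ts tm eqxx ge_min yE // ts tm lexx orbT.
rewrite estS //; case: ifP => _; rewrite ?ge_min IH // ltnW //.
Qed.

End Estimates.

(** * The matrix, and the program's values in terms of cells *)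

Section Matrix.
Context {R : realType} (D L reps B K : nat).

(* Row 0 holds the two constants of the program; every level then has a
   weight row, a row naming the parent cells and reps * B hash rows. *)
Definition matrix_entry (h : nat -> grid D -> nat) (r : nat) (p : grid D) : R :=
  if r == 0%N then (if flat p == 0%N then K%:R else (reps * B)%:R)
  else
    let i := (L - ((r - 1) %/ (reps * B + 2)).+1)%N in
    let o := ((r - 1) %% (reps * B + 2))%N in
    if o == 0%N then wgt (cell i) p
    else if o == 1%N then (flat (cell i.+1 p))%:R
    else (h ((o - 2) %/ B)%N (cell i p) == ((o - 2) %% B)%N)%:R.

Definition matrix_rows := (1 + L * (reps * B + 2))%N.

Definition block_row j := (1 + j * (reps * B + 2))%N.

Lemma matrix_entryE h j o p : (o < reps * B + 2)%N ->
  matrix_entry h (block_row j + o) p =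
    let i := (L - j.+1)%N in
    if o == 0%N then wgt (cell i) p
    else if o == 1%N then (flat (cell i.+1 p))%:R
    else (h ((o - 2) %/ B)%N (cell i p) == ((o - 2) %% B)%N)%:R.
Proof.
move=> oB; rewrite /matrix_entry /block_row -addnA add1n /= subn1 /=.
move: (_ + 2)%N oB => n on; have n0 : (0 < n)%N by exact: leq_ltn_trans on.
by rewrite divnMDl // divn_small // addn0 modnMDl modn_small.
Qed.

Variables (h : nat -> grid D -> nat) (x : grid D -> R) (lam : R).
Hypothesis B0 : (0 < B)%N.
Hypothesis D2 : (1 < D)%N.
Hypothesis DL : (D <= 2 ^ L)%N.
Hypothesis dx : is_dist x.
Hypothesis hB : forall s c, (h s c < B)%N.

Let M (r : 'I_matrix_rows) p := matrix_entry h r p.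
Let A := load_real lam M (sketch M x) 1.
Let y := load_real lam M (sketch M x) 2.

Let AE r p : (r < matrix_rows)%N -> A (r * (D * D) + flat p)%N = matrix_entry h r p.
Proof. by move=> rm; exact: (load_realA lam M _ (Ordinal rm)). Qed.

Let yE r : (r < matrix_rows)%N -> y r = \sum_p matrix_entry h r p * x p.
Proof. by move=> rm; exact: (load_realy lam M _ (Ordinal rm)). Qed.

Let D0 : (0 < D)%N. Proof. exact: ltnW. Qed.

Lemma load_header0 : A 0%N = K%:R.
Proof.
have := @AE 0%N (Ordinal D0, Ordinal D0) isT.
by rewrite /flat /= mul0n add0n => ->.
Qed.

(** The second constant sits at the point (0, 1), which exists because the grid has side at least
    2. *)
Lemma load_header1 : A 1%N = (reps * B)%:R.
Proof.
have := @AE 0%N (Ordinal D0, Ordinal D2) isT.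
by rewrite /flat /= mul0n add0n => ->.
Qed.

Let block_row_lt j o : (j < L)%N -> (o < reps * B + 2)%N ->
  (block_row j + o < matrix_rows)%N.
Proof.
move=> jL oB; rewrite /block_row /matrix_rows.
have : (j.+1 * (reps * B + 2) <= L * (reps * B + 2))%N by rewrite leq_mul2r jL orbT.
by rewrite mulSn; lia.
Qed.

(** The value 1 beyond the top level keeps the estimates nonnegative and constant on cells at all
    scales, as [allocate] expects. *)
Definition level_est (i : nat) (p : grid D) : R :=
  if (i < L)%N then
    let r := block_row (L - i.+1) in
    est_rows A y (D * D) (r * (D * D) + D * D + D * D) (r + 2) (reps * B) (flat p)
  else 1.

Let block_hash j t p : (j < L)%N -> (t < reps * B)%N ->
  matrix_entry h (block_row j + 2 + t) p =
  (h (t %/ B)%N (cell (L - j.+1) p) == (t %% B)%N)%:R.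
Proof.
move=> jL tB; rewrite -addnA matrix_entryE; last by rewrite addnC ltn_add2r.
by rewrite add2n /= subSS subn1.
Qed.

Let blockA j t p : (j < L)%N -> (t < reps * B)%N ->
  A (block_row j * (D * D) + D * D + D * D + t * (D * D) + flat p)%N
   = (h (t %/ B)%N (cell (L - j.+1) p) == (t %% B)%N)%:R.
Proof.
move=> jL tB; rewrite -block_hash // -AE; last first.
  by rewrite -addnA; apply: block_row_lt; rewrite // addnC ltn_add2r.
by congr A; rewrite !mulnDl; lia.
Qed.

Let blocky j t : (j < L)%N -> (t < reps * B)%N ->
  y (block_row j + 2 + t)%N
   = \sum_(q | h (t %/ B)%N (cell (L - j.+1) q) == (t %% B)%N) x q.
Proof.
move=> jL tB; rewrite yE; last first.
  by rewrite -addnA; apply: block_row_lt; rewrite // addnC ltn_add2r.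
rewrite [RHS]big_mkcond; apply: eq_bigr => p _; rewrite block_hash //.
by case: ifP; rewrite ?mul1r ?mul0r.
Qed.

Let levelK i : (i < L)%N -> (L - i.+1 < L)%N /\ (L - (L - i.+1).+1)%N = i.
Proof. by move=> iL; split; lia. Qed.

Lemma level_est_ge i p : (i < L)%N -> cellsum (cell i) x p <= level_est i p.
Proof.
move=> iL; rewrite /level_est iL; have [jL jE] := levelK iL.
apply: (@est_rows_ge R D A y _ _ B reps i h x) => //; try by case: dx.
- by move=> t q tB; rewrite blockA // jE.
- by move=> t tB; rewrite blocky // jE.
Qed.

Lemma level_est_ge0 i p : 0 <= level_est i p.
Proof.
have [iL|iL] := ltnP i L; last by rewrite /level_est ltnNge iL /= ler01.
by apply: le_trans (level_est_ge p iL); apply: cellsum_ge0; case: dx.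
Qed.

Lemma level_est_cell i p q : cell i p = cell i q -> level_est i p = level_est i q.
Proof.
rewrite /level_est; case: ifP => // iL pq; have [jL jE] := levelK iL.
apply: (@est_rows_cell R D A y _ _ B reps i h) => // t u tB.
by rewrite blockA // jE.
Qed.

Lemma level_est_le i s p : (i < L)%N -> (s < reps)%N ->
  level_est i p <= cellsum (cell i) x p + noise (cell i) (h s) x p.
Proof.
move=> iL sr; rewrite /level_est iL; have [jL jE] := levelK iL.
apply: (@est_rows_le_bucket R D A y _ _ B reps i h x) => //; try by case: dx.
- by move=> t q tB; rewrite blockA // jE.
- by move=> t tB; rewrite blocky // jE.
Qed.

(** Flat sums become sums over the grid, and comparing entries of the parent row amounts to
    comparing parents because [flat] is injective. Blocks are stored from the coarsest level down,
    in step with [allocate]. *)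
Lemma levels_flat_allocate j p : (j <= L)%N ->
  levels_flat A y (D * D) (reps * B) j (flat p) =
    allocate L (fun i => truncate_top (cell i) K (level_est i)) j p.
Proof.
elim: j p => [//|j IH] p jL /=.
set i := (L - j.+1)%N; set RB := (reps * B)%N.
have iL : (i < L)%N by rewrite /i; lia.
have ij : (L - i.+1 = j)%N by rewrite /i; lia.
rewrite -/(block_row j) /level_flat.
have wE (q : grid D) : A (block_row j * (D * D) + flat q)%N = wgt (cell i) q.
  rewrite AE; last by have := @block_row_lt j 0 jL; rewrite addn0; apply; rewrite addn2.
  by have := @matrix_entryE h j 0 q; rewrite addn0 => ->; rewrite ?addn2.
have pE (q : grid D) : A (block_row j * (D * D) + (D * D) + flat q)%N = (flat (cell i.+1
  q))%:R.
  have -> : (block_row j * (D * D) + (D * D) + flat q = (block_row j + 1) * (D * D) +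
    flat q)%N.
    by rewrite mulnDl mul1n.
  rewrite AE; last by apply: block_row_lt; rewrite // addn2.
  by rewrite matrix_entryE // addn2.
have eE (q : grid D) : est_rows A y (D * D) (block_row j * (D * D) + (D * D) + (D * D))
  (block_row j + 2) RB (flat q)
    = level_est i q by rewrite /level_est iL ij.
have bE (q : grid D) : top_flat A (D * D) (block_row j * (D * D))
    (est_rows A y (D * D) (block_row j * (D * D) + (D * D) + (D * D)) (block_row j + 2)
      RB) (flat q)
    = truncate_top (cell i) K (level_est i) q.
  rewrite /top_flat /truncate_top /rank_weight load_header0 eE.
  rewrite (sum_flat (fun q' => if level_est i q <= est_rows A y (D * D) (block_row j * (D
    * D) + (D * D) + (D * D)) (block_row j + 2) RB q'
    then A (block_row j * (D * D) + q')%N else 0)).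
  by under eq_bigr do rewrite eE wE.
have sE (q q' : grid D) : same_parent A (block_row j * (D * D) + (D * D)) (flat q) (flat q')
    = (cell i.+1 q' == cell i.+1 q).
  by rewrite /same_parent !pE eqr_nat (inj_eq flat_inj).
rewrite /split_flat /split_mass /child_sum /cellsum.
rewrite (sum_flat (fun q => if same_parent A (block_row j * (D * D) + (D * D)) (flat p) q
   then A (block_row j * (D * D) + q)%N * top_flat A (D * D) (block_row j * (D * D))
    (est_rows A y (D * D) (block_row j * (D * D) + (D * D) + (D * D)) (block_row j + 2)
      RB) q else 0)).
rewrite (sum_flat (fun q => if same_parent A (block_row j * (D * D) + (D * D)) (flat p) q
   then A (block_row j * (D * D) + q)%N else 0)).
under eq_bigr do rewrite sE wE bE.
under [X in _ / X]eq_bigr do rewrite sE wE -[wgt _ _]mulr1.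
by rewrite -!big_mkcond /= IH ?(ltnW jL) // bE.
Qed.

End Matrix.

(** * Success probability and error of the scheme *)

Section Guarantee.
Context {R : realType} (D k L : nat).
Hypotheses (D2 : (1 < D)%N) (k0 : (0 < k)%N) (DL : (D <= 2 ^ L)%N).

(** [3 * L + 2] repetitions serve a union bound over [L] levels and [D * D] points with failure 1/4,
    as [L] and [D] are at most [2 ^ L]. The successor form makes ['I_reps] visibly inhabited. *)
Definition reps := (3 * L + 1).+1.

(** One family of hash functions serves all levels, since failures at different levels are combined
    by a union bound. *)
Definition hashes := {ffun 'I_reps -> {ffun grid D -> 'I_(20 * k)}}.

Definition hash_fun (w : hashes) (s : nat) (c : grid D) : nat := w (inord s) c.

Definition good_hashes (x : grid D -> R) (F : nat -> R) : pred hashes :=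
  fun w => [forall i : 'I_L, forall p, exists s : 'I_reps,
    ~~ (F i / k%:R < noise (cell i) (fun c => w s c) x p)].

Lemma levels_gt0 : (0 < L)%N.
Proof. by case: L DL => //; rewrite expn0 leqNgt D2. Qed.

Lemma pow2_reps : (4 * (L * (D * D)) <= 2 ^ reps)%N.
Proof.
have -> : reps = (2 + (L + (L + L)))%N by rewrite /reps; lia.
rewrite !expnD.
by rewrite leq_mul2l /= leq_mul ?leq_mul // ltnW // ltn_expl.
Qed.

(** For a fixed input and plan, a level and a point are bad in all repetitions with probability at
    most [2 ^ reps] inverted. The union bound leaves 3/4, which exceeds 2/3. *)
Lemma card_good_hashes (x : grid D -> R) (y : grid D -> R) v :
  sparse k y -> is_plan x y v ->
  2 / 3 * #|hashes|%:R
    <= #|[pred w | good_hashes x (fun i => \sum_p far_mass v i p) w]|%:R :> R.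
Proof.
move=> sy pv; pose F i : R := \sum_p far_mass v i p.
rewrite -/F; have [v0 _ _] := pv.
pose bad (ip : 'I_L * grid D) (h : {ffun grid D -> 'I_(20 * k)}) :=
  F ip.1 / k%:R < noise (cell ip.1) (fun c => h c) x ip.2.
pose allbad ip (w : hashes) := [forall s, bad ip (w s)].
have bound ip : (2 ^ reps * #|[pred w | allbad ip w]| <= #|hashes|)%N.
  apply: card_all_bad.
  have [NS sNS fE] := far_mass_sparse ip.1 pv sy.
  apply: (card_noise (f := far_mass v ip.1) (NS := NS)) => //.
  by move=> q; apply: sumr_ge0.
have union := card_exists_le allbad.
have cardbad : (4 * #|[pred w | [exists ip, allbad ip w]]| <= #|hashes|)%N.
  have n0 : (0 < L * (D * D))%N by rewrite !muln_gt0 levels_gt0 ltnW.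
  rewrite -(leq_pmul2l n0).
  have -> : (L * (D * D) * #|hashes| = \sum_(ip : 'I_L * grid D) #|hashes|)%N.
    by rewrite sum_nat_const !card_prod !card_ord.
  apply: (@leq_trans (2 ^ reps * #|[pred w | [exists ip, allbad ip w]]|)).
    by rewrite mulnCA mulnA leq_mul2r pow2_reps orbT.
  apply: (leq_trans (leq_mul (leqnn _) union)).
  by rewrite big_distrr leq_sum.
have compl : (#|[pred w | [exists ip, allbad ip w]]| +
    #|[pred w | good_hashes x F w]| = #|hashes|)%N.
  rewrite -(cardC [pred w | [exists ip, allbad ip w]]); congr (_ + _)%N.
  apply: eq_card => w; rewrite !inE negb_exists /good_hashes.
  apply/forallP/forallP => [H [i p]|H i].
    by have /forallP/(_ p) := H i; rewrite negb_forall.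
  by apply/forallP => p; have := H (i, p); rewrite negb_forall.
have : 4 * #|[pred w | [exists ip, allbad ip w]]|%:R <= #|hashes|%:R :> R.
  by rewrite -natrM ler_nat.
have : #|[pred w | [exists ip, allbad ip w]]|%:R + #|[pred w | good_hashes x F w]|%:R
   = #|hashes|%:R :> R by rewrite -natrD compl.
have : 0 <= #|[pred w | [exists ip, allbad ip w]]|%:R :> R by exact: ler0n.
set a := #|_|%:R; set b := #|_|%:R; set c := #|_|%:R; lra.
Qed.

Variable lam : R.

Definition emd_rows := matrix_rows L reps (20 * k).

Definition emd_entry (w : hashes) (r : 'I_emd_rows) (p : grid D) : R :=
  matrix_entry L reps (20 * k) (10 * k) (hash_fun w) r p.

(** Phrased through the initial memory of the program, so that the program's output agrees with it
    by definition. *)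
Definition emd_recover (A : 'I_emd_rows -> grid D -> R) (y : 'I_emd_rows -> R)
    (p : grid D) : R :=
  levels_flat (load_real lam A y 1) (load_real lam A y 2) (D * D)
    (reps * (20 * k)) L (flat p).

Let B0 : (0 < 20 * k)%N. Proof. by rewrite muln_gt0. Qed.

Let hB (w : hashes) s c : (hash_fun w s c < 20 * k)%N.
Proof. exact: ltn_ord. Qed.

Definition emd_est (w : hashes) x := level_est L reps (20 * k) (10 * k) (hash_fun w) x lam.

Lemma emd_recoverE w x : is_dist x ->
  emd_recover (emd_entry w) (sketch (emd_entry w) x)
  = allocate L (fun i => truncate_top (cell i) (10 * k) (emd_est w x i)) L.
Proof.
by move=> dx; apply: funext => p; exact: levels_flat_allocate.
Qed.

Lemma emd_recover_dist w x : is_dist x ->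
  is_dist (emd_recover (emd_entry w) (sketch (emd_entry w) x)).
Proof.
move=> dx; rewrite emd_recoverE //; apply: (allocate_dist DL) => [i p|i p q pq|];
  last exact: ltnW.
  by rewrite /truncate_top; case: ifP => // _; exact: level_est_ge0.
by rewrite /truncate_top /rank_weight /emd_est (level_est_cell _ (10 * k) (hash_fun w) x
  lam B0 D2 DL pq).
Qed.

Lemma emd_recover_error w x y v : is_dist x -> sparse k y -> is_plan x y v ->
  good_hashes x (fun i => \sum_p far_mass v i p) w ->
  EMD x (emd_recover (emd_entry w) (sketch (emd_entry w) x)) <= 928 * plan_cost v.
Proof.
move=> dx sy pv gw; rewrite emd_recoverE //.
apply: (EMD_allocate_truncate _ DL k0 dx sy pv); first exact: ltnW.
- by move=> i p; exact: level_est_ge0.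
- by move=> i p q; exact: level_est_cell.
move=> i p iL; rewrite level_est_ge //=.
have /forallP/(_ (Ordinal iL))/forallP/(_ p)/existsP[s /=] := gw.
rewrite -leNgt => Hs.
apply: (le_trans (level_est_le (10 * k) x lam B0 D2 DL (@hB w) p iL (ltn_ord s))).
rewrite lerD2l; apply: le_trans Hs; rewrite /hash_fun.
by rewrite (_ : inord s = s) // inord_val.
Qed.

End Guarantee.

(** * Sketch size and running time *)

Section Size.
Context {R : realType}.

Lemma lg_ge1 (t : R) : 1 <= lg t.
Proof. by rewrite le_max lexx. Qed.

Lemma up_log_le_lg D : (1 < D)%N -> (up_log 2 D)%:R <= 2 * lg D%:R :> R.
Proof.
move=> D2; have /andP[H _] := up_log_bounds (isT : 1 < 2)%N D2.
have l2 : 0 < ln 2 :> R by rewrite ln_gt0 // ltr1n.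
have : (up_log 2 D).-1%:R <= lg D%:R :> R.
  rewrite le_max; apply/orP; right; rewrite ler_pdivlMr //.
  rewrite mulr_natl -lnXn // -natrX ler_ln ?posrE ?ltr0n ?expn_gt0 ?(ltnW D2) //.
  by rewrite ler_nat ltnW.
have := lg_ge1 (D%:R : R); case: (up_log 2 D) => [|n] /=; first by lra.
by rewrite -natr1; lra.
Qed.

(** 103 = 1 + 2 + 40 + 60, each lower-order term being absorbed into [k * (L * L)]. *)
Lemma emd_rows_le (k L : nat) : (0 < k)%N -> (0 < L)%N ->
  (emd_rows k L <= 103 * (k * (L * L)))%N.
Proof.
move=> k0 L0; rewrite /emd_rows /matrix_rows /reps.
have -> : (1 + L * ((3 * L + 1).+1 * (20 * k) + 2) =
  1 + 2 * L + 40 * (k * L) + 60 * (k * (L * L)))%N by ring.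
have h1 : (L <= L * L)%N by rewrite leq_pmulr.
have h2 : (k * L <= k * (L * L))%N by rewrite leq_mul2l h1 orbT.
have h3 : (L <= k * L)%N by rewrite leq_pmull.
by lia.
Qed.

(** The time is at most [1024 * D ^ 6], and 1024 is absorbed by [D ^ 10] as [D] is at least 2. *)
Lemma emd_time_le D k L : (1 < D)%N -> (0 < k)%N -> (k <= D * D)%N -> (L <= D)%N ->
  (D * 3 + D * D * 3 + L * (level_time (D * D) (reps L * (20 * k))).+1 + 10
    <= D ^ 16)%N.
Proof.
move=> D2 k0 kD LD.
have RB : (reps L * (20 * k) <= 80 * D ^ 3)%N.
  apply: (@leq_trans ((4 * D) * (20 * (D * D)))).
    by apply: leq_mul; [rewrite /reps; lia | rewrite leq_mul2l kD orbT].
  by rewrite !expnS expn0; lia.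
have D0 : (0 < D)%N by exact: ltnW.
have pw i j : (i <= j)%N -> (D ^ i <= D ^ j)%N by move=> ij; rewrite leq_pexp2l.
have lt : (level_time (D * D) (reps L * (20 * k)) < 1000 * D ^ 5)%N.
  rewrite /level_time; apply: (@leq_ltn_trans
    (80 * D ^ 3 * (D * D * 5 + 6) + D * D * (D * D * 10 + 18) + 20)).
    by rewrite !leq_add2r leq_mul2r RB orbT.
  have e1 : (80 * D ^ 3 * (D * D * 5 + 6) + D * D * (D * D * 10 + 18) + 20 =
     400 * D ^ 5 + 480 * D ^ 3 + 10 * D ^ 4 + 18 * D ^ 2 + 20 * D ^ 0)%N by ring.
  have := pw 0%N 5%N isT; have := pw 2%N 5%N isT; have := pw 3%N 5%N isT;
    have := pw 4%N 5%N isT.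
  have : (0 < D ^ 5)%N by rewrite expn_gt0 D0.
  by rewrite e1; lia.
have lt2 : (L * (level_time (D * D) (reps L * (20 * k))).+1 <= 1000 * D ^ 6)%N.
  by apply: leq_trans (leq_mul LD lt) _; rewrite [(D ^ 6)%N]expnS; lia.
have e2 : (1024 <= D ^ 10)%N by apply: (@leq_trans (2 ^ 10)); rewrite // leq_exp2r.
apply: (@leq_trans (1024 * D ^ 6)).
  have e3 : (D * 3 + D * D * 3 + 10 = 3 * D ^ 1 + 3 * D ^ 2 + 10 * D ^ 0)%N by ring.
  have := pw 0%N 6%N isT; have := pw 1%N 6%N isT; have := pw 2%N 6%N isT.
  by lia.
by rewrite (_ : 16 = 10 + 6)%N // expnD leq_mul2r e2 orbT.
Qed.

End Size.

Theorem mainTheorem11 (R : realType) :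
  exists (delta c_size c_approx : R) (c_time : nat) (prog : cmd),
  [/\ 0 < delta, 0 < c_size, 0 < c_approx &
  forall (D k : nat) (lam : R), (2 <= D)%N -> (1 <= k)%N -> 0 < lam ->
  exists (m : nat) (S : sketching_scheme R D m),
    [/\ m%:R <= c_size * (lg D%:R `^ delta)
                * (k%:R * lg (lg D%:R) * lg (lg k%:R) + lg (lg (D%:R / lam))),
        forall x : grid D -> R, is_dist x ->
          holds_with_prob (S := S) (2 / 3) (fun w =>
            is_dist (scheme_output w x) /\
            EMD x (scheme_output w x)
              <= Num.max (c_approx * lg k%:R * EMD_sparse k x) lam) &
        recovery_runs_in k lam S prog
          (c_time%:R * (D%:R + lg D%:R ^+ (c_time * k)) ^+ c_time)]].
Proof.
(* The exponent 2 pays for levels times repetitions. 412 = 4 * 103 uses [L <= 2 * lg D]. 2000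
   exceeds 2 * 928, the plan being taken within a factor 2 of a positive optimum. 16 is the degree
   of the time bound. *)
exists 2, 412, 2000, 16%N, emd_prog; split; [lra | lra | lra |].
move=> D k lam D2 k0 lam0.
(* Every vector on the grid is [D * D]-sparse, so capping [k] loses nothing and keeps the time
   polynomial in [D] for large [k]. *)
pose kk := minn k (D * D); pose L := up_log 2 D.
have D0 : (0 < D)%N by exact: ltnW.
have kk0 : (0 < kk)%N by rewrite leq_min k0 muln_gt0 D0.
have DL : (D <= 2 ^ L)%N by exact: up_logP.
have L0 : (0 < L)%N by exact: levels_gt0 D2 DL.
have LD : (L <= D)%N.
  have /andP[h _] := up_log_bounds (isT : 1 < 2)%N D2.
  by rewrite -(prednK L0); apply: leq_trans h; rewrite ltnS ltnW // ltn_expl.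
have B0 : (0 < 20 * kk)%N by rewrite muln_gt0.
pose w0 : hashes D kk L := [ffun=> [ffun=> Ordinal B0]].
exists (emd_rows kk L), (finite_scheme w0 (@emd_entry R D kk L) (@emd_recover R D kk L
  lam)).
split.
- have l1 := lg_ge1 (D%:R : R).
  rewrite powR_mulrn; last by lra.
  have rows : (emd_rows kk L)%:R <= 103 * (k%:R * (L%:R * L%:R)) :> R.
    rewrite -!natrM ler_nat (leq_trans (emd_rows_le kk0 L0)) // leq_mul2l /=.
    by rewrite leq_mul2r geq_minl orbT.
  have LL : L%:R * L%:R <= 4 * lg (D%:R : R) ^+ 2.
    have := up_log_le_lg (R := R) D2; rewrite -/L => H.
    have -> : 4 * lg (D%:R : R) ^+ 2 = (2 * lg D%:R) * (2 * lg D%:R) by ring.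
    exact: ler_pM.
  apply: (le_trans rows).
  apply: (@le_trans _ _ (412 * lg (D%:R : R) ^+ 2 * k%:R)).
    have -> : 412 * lg (D%:R : R) ^+ 2 * k%:R = 103 * (k%:R * (4 * lg (D%:R : R) ^+ 2))
      by ring.
    by rewrite !ler_wpM2l.
  apply: ler_wpM2l; first by apply: mulr_ge0; [lra | apply: exprn_ge0; lra].
  apply: ler_wpDr; first by apply: le_trans (lg_ge1 _); exact: ler01.
  rewrite -mulrA ler_peMr // -[1]mulr1 ler_pM //; exact: lg_ge1.
- move=> x dx.
  have [e e0 He] : exists2 e : R, 0 < e &
      928 * (EMD_sparse k x + e) <= Num.max (2000 * lg k%:R * EMD_sparse k x) lam.
    have [opt0 _] := EMD_sparse_plan D0 k0 dx lam0.
    have [opt_eq0|opt_neq0] := eqVneq (EMD_sparse k x) 0.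
      exists (lam / 928); first by apply: divr_gt0; lra.
      by rewrite le_max; apply/orP; right; rewrite opt_eq0; lra.
    exists (EMD_sparse k x); first by rewrite lt0r opt_neq0.
    rewrite le_max; apply/orP; left.
    have : EMD_sparse k x <= lg k%:R * EMD_sparse k x by rewrite ler_peMl ?lg_ge1.
    by rewrite -mulrA; set u := lg _ * EMD_sparse k x; lra.
  have [_ [y [v [sy pv cost]]]] := EMD_sparse_plan D0 k0 dx e0.
  have sy' : sparse kk y.
    by rewrite /sparse leq_min sy (leq_trans (max_card _)) // card_prod !card_ord.
  apply: (holds_with_prob_finite (card_good_hashes (L := L) D2 kk0 DL sy' pv)) => j gj.
  split; first exact: emd_recover_dist.
  apply: (le_trans (emd_recover_error D2 kk0 DL lam dx sy' pv gj)).
  by apply: le_trans He; apply: ler_wpM2l; [lra | exact: ltW].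
- move=> j x dx.
  set M := scheme_matrix _.
  have AR : load_real lam M (sketch M x) 1 1 = (reps L * (20 * kk))%:R.
    exact: load_header1.
  have [t [s [run time out]]] := runs_emd_prog (s := load k lam M (sketch M x))
    (nl := L) (RB := reps L * (20 * kk)) erefl erefl
    AR erefl erefl erefl.
  exists t, s; split=> //; last first.
    by move=> p; rewrite /read_output out ?flat_lt.
  apply: (@le_trans _ _ ((D ^ 16)%:R)).
    rewrite ler_nat; apply: (leq_trans time).
    exact: (emd_time_le D2 kk0 (geq_minr _ _) LD).
  rewrite natrX; apply: (@le_trans _ _ ((D%:R + lg D%:R ^+ (16 * k)) ^+ 16)).
    by rewrite lerXn2r ?nnegrE ?addr_ge0 ?lerDl ?exprn_ge0 // (le_trans ler01) ?lg_ge1.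
  rewrite ler_peMl ?ler1n // exprn_ge0 // addr_ge0 // exprn_ge0 //.
  by rewrite (le_trans ler01) ?lg_ge1.
Qed.
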